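(* Let $k_1\geq k_2\geq t+2$ with $(k_1,k_2)\neq(3,3)$, and let $n\geq 2L(k_1,t)$. If $\mathcal{F}_1\subseteq\Pi(n,k_1)$ and $\mathcal{F}_2\subseteq\Pi(n,k_2)$ are non-trivial cross $t$-intersecting families maximizing $|\mathcal{F}_1||\mathcal{F}_2|$ (among all non-trivial cross $t$-intersecting pairs in $\Pi(n,k_1)\times\Pi(n,k_2)$), then $(\mathcal{F}_1,\mathcal{F}_2)$ is isomorphic to one of $(\mathcal{A}(k_1,k_2,t),\mathcal{B}(k_2,t))$, $(\mathcal{B}(k_1,t),\mathcal{A}(k_2,k_1,t))$, $(\mathcal{C}(k_1,t),\mathcal{D}(k_2,t))$, $(\mathcal{D}(k_1,t),\mathcal{C}(k_2,t))$.
   Context: All letters denote positive integers. $[n]=\{1,\ldots,n\}$. A partition is a set of pairwise disjoint nonempty sets (blocks); $|P|$ is its number of blocks and $\cup P$ the union of its blocks. $\Pi(n,k)$ is the set of all partitions of $[n]$ into $k$ blocks; $S(n,k)=|\Pi(n,k)|$ (Stirling number of the second kind). For partitions $F,G$, $F\cap G$ is the set of common blocks. For $s\geq1$, $[[s]]:=\{\{1\},\ldots,\{s\}\}$. $L(k,t):=(t+1)+(k-t+1)\log_2((t+1)(k-t+1))$. $\mathcal{F}\subseteq\Pi(n,k)$, $\mathcal{G}\subseteq\Pi(n,\ell)$ are cross $t$-intersecting if $|F\cap G|\geq t$ for all $F\in\mathcal{F},G\in\mathcal{G}$; they are non-trivial if the set of blocks belonging to every member of $\mathcal{F}\cup\mathcal{G}$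 has fewer than $t$ elements. Two pairs of families are isomorphic if one is obtained from the other by applying a single permutation of $[n]$ to all blocks. Constructions: for an $\ell$-partition $M$ (of a subset of $[n]$) and $X\subseteq M$ with $|X|=t$, put $\overline{\cup M}=[n]\setminus\cup M$ and $\mathcal{A}(k,X,M)=\{F\in\Pi(n,k):X\subseteq F,\ F\cap(M\setminus X)\neq\emptyset\}$, $\mathcal{B}(\ell,X,M)=\{F\in\Pi(n,\ell):X\subseteq F\}\cup\{(M\setminus\{B\})\cup\{B\cup\overline{\cup M}\}:B\in X\}$; $\mathcal{A}(k,\ell,t)=\mathcal{A}(k,[[t]],[[\ell]])$, $\mathcal{B}(\ell,t)=\mathcal{B}(\ell,[[t]],[[\ell]])$. For a $(t+1)$-partition $T$: $\mathcal{C}(k,T)=\{F\in\Pi(n,k):T\subseteq F\}$, $\mathcal{D}(\ell,T)=\{F\in\Pi(n,\ell):|T\cap F|\geq t\}$; $\mathcal{C}(k,t)=\mathcal{C}(k,[[t+1]])$, $\mathcal{D}(\ell,t)=\mathcal{D}(\ell,[[t+1]])$. *)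

(* Defs.v *)
From Stdlib Require Import Reals.
From mathcomp Require Import all_boot all_order all_fingroup.
Set Implicit Arguments. Unset Strict Implicit. Unset Printing Implicit Defensive.

(* The ground set [n] = {1..n} is represented by 'I_n = {0..n-1} (i <-> i+1). *)
Notation block n := {set 'I_n}.
Notation spart n := {set {set 'I_n}}.
Notation pfamily_of n := {set {set {set 'I_n}}}.

Definition is_kpart (n k : nat) (P : spart n) : bool :=
  partition P [set: 'I_n] && (#|P| == k).

Definition Pi (n k : nat) : pfamily_of n := [set P | is_kpart k P].

Definition sing (n s : nat) : spart n := [set [set i] | i : 'I_n & i < s].

Definition L (k t : nat) : R :=
  Rplus (INR (t + 1))
    (Rmult (INR (k - t + 1)) (Rdiv (ln (INR ((t + 1) * (k - t + 1)))) (ln (INR 2)))).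

Definition cross_tint (n t : nat) (F G : pfamily_of n) : Prop :=
  forall A B, A \in F -> B \in G -> t <= #|A :&: B|.

Definition common_blocks (n : nat) (F G : pfamily_of n) : {set block n} :=
  [set B | [forall P in F :|: G, B \in P]].

Definition nontrivial (n t : nat) (F G : pfamily_of n) : Prop :=
  #|common_blocks F G| < t.

Definition perm_part (n : nat) (s : {perm 'I_n}) (P : spart n) : spart n :=
  [set s @: (B : {set _}) | B in P].
Definition perm_fam (n : nat) (s : {perm 'I_n}) (F : pfamily_of n) : pfamily_of n :=
  [set perm_part s P | P in F].

Definition iso_pair (n : nat) (F1 F2 G1 G2 : pfamily_of n) : Prop :=
  exists s : {perm 'I_n}, perm_fam s G1 = F1 /\ perm_fam s G2 = F2.

Definition Afam (n k : nat) (X M : spart n) : pfamily_of n :=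
  [set F in Pi n k | (X \subset F) && (F :&: (M :\: X) != set0)].

Definition Bfam (n l : nat) (X M : spart n) : pfamily_of n :=
  [set F in Pi n l | X \subset F] :|:
  [set (M :\ B) :|: [set B :|: ~: cover M] | B in X].

Definition Cfam (n k : nat) (T : spart n) : pfamily_of n :=
  [set F in Pi n k | T \subset F].

Definition Dfam (n l t : nat) (T : spart n) : pfamily_of n :=
  [set F in Pi n l | t <= #|T :&: F|].

Arguments Afam : clear implicits.
Arguments Bfam : clear implicits.
Arguments Cfam : clear implicits.
Arguments Dfam : clear implicits.

Definition A3 (n k l t : nat) : pfamily_of n := Afam n k (sing n t) (sing n l).
Definition B2 (n l t : nat) : pfamily_of n := Bfam n l (sing n t) (sing n l).
Definition C2 (n k t : nat) : pfamily_of n := Cfam n k (sing n t.+1).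
Definition D2 (n l t : nat) : pfamily_of n := Dfam n l t (sing n t.+1).

(* Main.v *)
Require Import Defs.
From Stdlib Require Import Reals Lra.
From mathcomp Require Import all_boot all_order all_fingroup zify.
Set Implicit Arguments. Unset Strict Implicit. Unset Printing Implicit Defensive.

(** Call [star_size n k j], the Stirling number [S(n-j, k-j)], the size of a star: at
    most that many [k]-partitions contain [j < k] given blocks, with equality for
    singleton blocks.  The threshold [n >= 2 L(k1, t)] makes star sizes drop by a
    factor [N ^ 2], [N = (t+1)(k1-t+1)], each time [j] grows by one.

    If [Y] is not a [t]-cover of [H], every member of [F] through [Y] meets a fixed
    set of [l-t+1] blocks outside [Y].  Iterating up to the least size of a [t]-cover
    bounds [|F||H|] by [star_size n k (t+1) * star_size n l t], which the pairs (A, B)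
    and (C, D) exceed by factors close to [l-t] and [t+1], unless one family, say [F],
    has [t] common blocks [X].  Call a block [b] heavy if [b |: X] is a [t]-cover of
    [H] contained in a member of [F]; there are at most [l-t] heavy blocks.  If one of
    them belongs to all of [F], the pair is contained in some (C, D); if there are
    [l-t] of them, it is contained in some (A, B); otherwise the product is too small.
    Maximality turns inclusion into equality, and comparing sizes forces the
    prescribed blocks to be singletons.

    The index [k = t+2] needs care because [star_size n k (t+1) = 1] carries no
    information on block sizes: a one-element [F] is treated through its largest
    block, and the pairs (A, B) whose blocks outside [X] are not singletons lose to
    (D, C), except in the excluded case [(3, 3)]. *)

(** * Stirling numbers of the second kind *)

Fixpoint stirling2 (m j : nat) : nat :=
  match m, j with
  | 0, 0 => 1
  | 0, _.+1 => 0
  | _.+1, 0 => 0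
  | m'.+1, j'.+1 => j'.+1 * stirling2 m' j'.+1 + stirling2 m' j'
  end.

Lemma stirling2_Sn0 m : stirling2 m.+1 0 = 0. Proof. by []. Qed.

Lemma stirling2SS m j :
  stirling2 m.+1 j.+1 = j.+1 * stirling2 m j.+1 + stirling2 m j.
Proof. by []. Qed.

Lemma stirling2_small m j : m < j -> stirling2 m j = 0.
Proof.
elim: m j => [|m IHm] [|j] // lt_mj.
by rewrite stirling2SS !IHm ?muln0 // ltnW.
Qed.

Lemma stirling2nn m : stirling2 m m = 1.
Proof. by elim: m => // m IHm; rewrite stirling2SS IHm stirling2_small ?muln0. Qed.

Lemma stirling2_Sn1 m : stirling2 m.+1 1 = 1.
Proof. by elim: m => // m IHm; rewrite stirling2SS IHm. Qed.

Lemma stirling2_Sn2 m : stirling2 m.+1 2 = (2 ^ m).-1.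
Proof.
elim: m => // m IHm; rewrite stirling2SS IHm stirling2_Sn1.
by have := expn_gt0 2 m; rewrite /= expnS; lia.
Qed.

Lemma stirling2_gt0 m j : 0 < j <= m -> 0 < stirling2 m j.
Proof.
case: j => // j /=; elim: m => // m IHm.
rewrite ltnS leq_eqVlt => /predU1P[<-|lt_jm]; first by rewrite stirling2nn.
by rewrite stirling2SS addn_gt0 muln_gt0 IHm.
Qed.

Lemma leq_mul_stirling2 m j : j * stirling2 m j <= stirling2 m.+1 j.
Proof. by case: j => // j; rewrite stirling2SS leq_addr. Qed.

Lemma leq_expn_stirling2 c m u j :
  c <= j -> c ^ u * stirling2 m j <= stirling2 (m + u) j.
Proof.
move=> le_cj; elim: u => [|u IHu]; first by rewrite mul1n addn0.
rewrite expnS -mulnA addnS; apply: leq_trans (leq_mul_stirling2 _ _).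
exact: leq_mul.
Qed.

Lemma leq_stirling2 m1 m2 j :
  0 < j -> m1 <= m2 -> stirling2 m1 j <= stirling2 m2 j.
Proof.
move=> j_gt0 /subnKC<-.
by have := leq_expn_stirling2 m1 (m2 - m1) j_gt0; rewrite exp1n mul1n.
Qed.

Lemma leq_wexp2r m1 m2 e : m1 <= m2 -> m1 ^ e <= m2 ^ e.
Proof. by case: e => // e; rewrite leq_exp2r. Qed.

(* The ratio bound passes to both terms of the recurrence, because [j.+1 / j]
   decreases in [j]. *)
Lemma stirling2_ratio d j :
  j.+2 ^ d * stirling2 (j.+1 + d) j.+1 <= j.+1 ^ d * stirling2 (j.+2 + d) j.+2.
Proof.
elim: d j => [|d IHd] j; first by rewrite !addn0 !stirling2nn.
elim: j => [|j IHj].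
  rewrite exp1n mul1n addnS add1n addnS add2n stirling2_Sn1 stirling2_Sn2 muln1.
  by rewrite [2 ^ d.+2]expnS; have := expn_gt0 2 d.+1; lia.
rewrite !addnS in IHj *; rewrite [stirling2 _.+1 j.+2]stirling2SS.
rewrite [stirling2 _.+1 j.+3]stirling2SS mulnDr [leqRHS]mulnDr leq_add //.
  rewrite !expnS mulnACA [leqRHS]mulnACA [j.+2 * j.+3]mulnC leq_mul2l.
  exact: IHd.
rewrite -(leq_pmul2l (m := j.+2 ^ d.+1)) ?expn_gt0 // mulnCA.
apply: leq_trans (leq_mul (leqnn (j.+3 ^ d.+1)) IHj) _.
by rewrite !mulnA -!expnMn leq_mul2r leq_wexp2r ?orbT //; nia.
Qed.

Lemma stirling2SS_le m j :
  0 < j <= m -> stirling2 m.+1 j.+1 <= 2 ^ (m - j).+1 * stirling2 m j.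
Proof.
case: j => [//|[_|j]].
  case: m => // m; rewrite stirling2_Sn1 stirling2_Sn2 muln1 subn1.
  exact: leq_pred.
elim: m => // m IHm /andP[_]; rewrite ltnS leq_eqVlt => /predU1P[<-|lt_jm].
  by rewrite !stirling2nn subnn.
rewrite stirling2SS subSS -[m - j.+1]prednK ?subn_gt0 // -subnS.
have := IHm lt_jm; have := leq_mul_stirling2 m j.+2.
have := expn_gt0 2 (m - j.+2); rewrite ![2 ^ _.+1]expnS.
move: (2 ^ _) (stirling2 m.+1 j.+2) (stirling2 m _) (stirling2 m.+1 j.+3).
move=> a y x z a_gt0 le_xy le_zx.
have le_z : j.+3 * z <= 2 * a * (j.+3 * x) by rewrite mulnCA leq_mul2l le_zx orbT.
have le_x : 2 * a * (2 * (j.+3 * x)) <= 2 * a * (3 * y).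
  by rewrite leq_mul2l; apply/orP; right; nia.
have : y <= a * y by rewrite leq_pmull.
lia.
Qed.

(** * Counting set partitions *)

Lemma cardsD1_mem (T : finType) (A : {set T}) x : x \in A -> #|A :\ x|.+1 = #|A|.
Proof. by move=> Ax; rewrite (cardsD1 x A) Ax. Qed.

Lemma cardsD1_succ (T : finType) (A : {set T}) x m :
  #|A| = m.+1 -> x \in A -> #|A :\ x| = m.
Proof. by move=> cardA /cardsD1_mem; rewrite cardA => -[]. Qed.

Section CountPartitions.
Variable T : finType.
Implicit Types (D B C : {set T}) (P Q : {set {set T}}) (x : T).

Lemma partition_block_eq P D B C x :
  partition P D -> B \in P -> C \in P -> x \in B -> x \in C -> B = C.
Proof.
move=> /partition_trivIset tiP PB PC Bx Cx.
by rewrite -(def_pblock tiP PB Bx) (def_pblock tiP PC Cx).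
Qed.

Definition kpartitions D j : {set {set {set T}}} :=
  [set P | partition P D && (#|P| == j)].

Lemma kpartitionsP D j P :
  reflect (partition P D /\ #|P| = j) (P \in kpartitions D j).
Proof. by rewrite inE; apply: (iffP andP) => -[? /eqP]. Qed.

Section AddPoint.
Variables (x : T) (D : {set T}).
Hypothesis notDx : x \notin D.

Lemma set1_notin_partition Q : partition Q D -> [set x] \notin Q.
Proof.
move=> partQ; apply: contra notDx => /(partitionS partQ)/subsetP; apply.
exact: set11.
Qed.

Definition add_to_block (QB : {set {set T}} * {set T}) : {set {set T}} :=
  (x |: QB.2) |: (QB.1 :\ QB.2).

Definition remove_point P : {set {set T}} * {set T} :=
  ((pblock P x :\ x) |: (P :\ pblock P x), pblock P x :\ x).

Section AddToBlock.
Variables (Q : {set {set T}}) (B : {set T}).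
Hypotheses (partQ : partition Q D) (QB : B \in Q).

Let sBD : B \subset D. Proof. exact: partitionS partQ QB. Qed.
Let notBx : x \notin B. Proof. by apply: contra notDx; apply: subsetP. Qed.

Let xB_notin : x |: B \notin Q :\ B.
Proof.
apply: contra notDx => /setD1P[_ /(partitionS partQ)/subsetP]; apply.
exact: setU11.
Qed.

Lemma add_to_block_partition : partition (add_to_block (Q, B)) (x |: D).
Proof.
have -> : x |: D = (x |: B) :|: (D :\: B).
  by rewrite -setUA -[in LHS](setID D B) (setIidPr sBD).
apply: partitionU1; first exact: partitionD1.
  by apply/set0Pn; exists x; rewrite setU11.
apply/pred0P=> y; rewrite /= !inE; case: eqVneq => [->|_] /=.
  by rewrite (negbTE notDx) andbF.
by rewrite andbA andbN.
Qed.

Lemma card_add_to_block : #|add_to_block (Q, B)| = #|Q|.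
Proof. by rewrite cardsU1 xB_notin -(cardsD1_mem QB). Qed.

Lemma set1_notin_add_to_block : [set x] \notin add_to_block (Q, B).
Proof.
rewrite !inE negb_or negb_and set1_notin_partition // orbT andbT.
have /set0Pn[y By] := partition_neq0 partQ QB.
apply: contraNneq notBx => /setP/(_ y); rewrite !inE By orbT => /eqP<-.
exact: By.
Qed.

Lemma add_to_blockK : remove_point (add_to_block (Q, B)) = (Q, B).
Proof.
rewrite /remove_point (def_pblock (B := x |: B)) ?setU11 //.
  by rewrite setU1K // setU1K // setD1K.
exact: partition_trivIset add_to_block_partition.
Qed.

End AddToBlock.

Section RemovePoint.
Variable P : {set {set T}}.
Hypotheses (partP : partition P (x |: D)) (notPx : [set x] \notin P).
Local Notation C := (pblock P x).

Let cover_x : x \in cover P. Proof. by rewrite (cover_partition partP) setU11. Qed.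
Let PC : C \in P. Proof. exact: pblock_mem. Qed.
Let Cx : x \in C. Proof. by rewrite mem_pblock. Qed.

Let Cx_neq0 : C :\ x != set0.
Proof.
by apply: contraNneq notPx => Cx0; rewrite -(setU0 [set x]) -Cx0 setD1K.
Qed.

Let Cx_notin : C :\ x \notin P :\ C.
Proof.
apply: contraTN isT => /setD1P[/eqP neqC PCx]; have /set0Pn[y Cxy] := Cx_neq0.
have [_ Cy] := setD1P Cxy; case: neqC.
exact: partition_block_eq partP PCx PC Cxy Cy.
Qed.

Lemma remove_point_partition : partition (remove_point P).1 D.
Proof.
have -> : D = (C :\ x) :|: ((x |: D) :\: C).
  have /setP sC := setUidPr (partitionS partP PC).
  apply/setP=> y; move: (sC y); rewrite !inE; case: eqVneq => [->|_] /=.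
    by rewrite Cx (negbTE notDx).
  by case: (y \in C).
apply: partitionU1 => //; first exact: partitionD1.
apply/pred0P=> y; rewrite /= !inE.
by case: (y \in C); rewrite ?andbF.
Qed.

Lemma card_remove_point : #|(remove_point P).1| = #|P|.
Proof. by rewrite cardsU1 Cx_notin -(cardsD1_mem PC). Qed.

Lemma remove_pointK : add_to_block (remove_point P) = P.
Proof. by rewrite /add_to_block /= setD1K // setU1K // setD1K. Qed.

End RemovePoint.

Lemma card_kpartitions_singleton j :
  #|[set P in kpartitions (x |: D) j.+1 | [set x] \in P]| = #|kpartitions D j|.
Proof.
have notQx Q : Q \in kpartitions D j -> [set x] \notin Q.
  by case/kpartitionsP=> /set1_notin_partition.
rewrite -[RHS](card_in_imset (f := fun Q => [set x] |: Q)); last first.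
  by move=> Q1 Q2 /notQx/setU1K{2}<- /notQx/setU1K{2}<- ->.
apply: eq_card => P; apply/setIdP/imsetP => [[/kpartitionsP[partP cardP] Px]|[Q]].
  exists (P :\ [set x]); last by rewrite setD1K.
  apply/kpartitionsP; split; first by rewrite -(setU1K notDx) partitionD1.
  exact: cardsD1_succ.
move=> jQ ->; rewrite setU11; have [partQ cardQ] := kpartitionsP _ _ _ jQ.
split=> //; apply/kpartitionsP; rewrite cardsU1 notQx // cardQ.
by split=> //; apply: partitionU1; rewrite ?disjoints1 // -card_gt0 cards1.
Qed.

Lemma card_kpartitions_nonsingleton j :
  #|[set P in kpartitions (x |: D) j | [set x] \notin P]| = j * #|kpartitions D j|.
Proof.
pose pointed := [set QB : {set {set T}} * {set T}
  | (QB.1 \in kpartitions D j) && (QB.2 \in QB.1)].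
have pointedP Q B : (Q, B) \in pointed -> [/\ partition Q D, #|Q| = j & B \in Q].
  by rewrite inE => /andP[/kpartitionsP[]].
have -> : j * #|kpartitions D j| = #|pointed|.
  rewrite mulnC -sum_nat_const -sum1dep_card.
  rewrite -(pair_big_dep (mem (kpartitions D j)) (fun Q B => B \in Q) (fun _ _ => 1)) /=.
  by apply: eq_bigr => Q /kpartitionsP[_ <-]; rewrite sum1_card.
rewrite -[RHS](card_in_imset (f := add_to_block)); last first.
  apply: (@can_in_inj _ _ _ _ remove_point) => -[Q B] /pointedP[partQ _ QB].
  exact: add_to_blockK.
apply: eq_card => P; apply/setIdP/imsetP => [[/kpartitionsP[partP cardP] notPx]|].
  exists (remove_point P); last by rewrite remove_pointK.
  rewrite inE setU11 andbT; apply/kpartitionsP.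
  by rewrite card_remove_point //; split=> //; apply: remove_point_partition.
case=> -[Q B] /pointedP[partQ cardQ QB] ->; rewrite set1_notin_add_to_block //.
split=> //; apply/kpartitionsP; rewrite card_add_to_block //.
by split=> //; apply: add_to_block_partition.
Qed.

End AddPoint.

Lemma card_kpartitions_set0 j : #|kpartitions set0 j| = (j == 0).
Proof.
have -> : kpartitions set0 j = if j == 0 then [set set0] else set0.
  apply/setP=> P; rewrite inE partition_set0; case: (eqVneq P set0) => [->|neqP].
    by rewrite cards0 eq_sym; case: eqP => _; rewrite inE ?eqxx.
  by case: ifP => _; rewrite inE ?(negbTE neqP).
by case: eqP; rewrite (cards0, cards1).
Qed.

Lemma card_kpartitions D j : #|kpartitions D j| = stirling2 #|D| j.
Proof.
move cardD: #|D| => m; elim: m => [|m IHm] in D j cardD *.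
  by rewrite (cards0_eq cardD) card_kpartitions_set0; case: j.
have [x Dx] : exists x, x \in D by apply/set0Pn; rewrite -card_gt0 cardD.
have notDx : x \notin D :\ x by rewrite setD11.
have cardDx : #|D :\ x| = m := cardsD1_succ cardD Dx.
case: j => [|j].
  apply: eq_card0 => P; apply/negP=> /kpartitionsP[partP /cards0_eq P0].
  by move: Dx; rewrite -(cover_partition partP) P0 /cover big_set0 inE.
rewrite stirling2SS -!(IHm _ _ cardDx) -{1}(setD1K Dx).
rewrite -(cardsID [set P : {set {set T}} | [set x] \in P]) addnC; congr (_ + _).
  rewrite -(card_kpartitions_nonsingleton notDx) (setD1K Dx).
  by apply: eq_card => P; rewrite !inE andbC.
rewrite -(card_kpartitions_singleton notDx) (setD1K Dx).
by apply: eq_card => P; rewrite !inE.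
Qed.

End CountPartitions.

Section Blocks.
Variable T : finType.
Implicit Types (D B : {set T}) (P Q Y Z : {set {set T}}).

Lemma partition_coverE Y : partition Y (cover Y) = trivIset Y && (set0 \notin Y).
Proof. by rewrite /partition eqxx. Qed.

Lemma sub_partition_cover P Y D :
  partition P D -> Y \subset P -> partition Y (cover Y).
Proof.
case/and3P=> _ tiP P0 sYP; rewrite partition_coverE (trivIsetS sYP) //.
by apply: contra P0; apply: subsetP.
Qed.

Lemma partition_setD P Y D :
  partition P D -> Y \subset P -> partition (P :\: Y) (D :\: cover Y).
Proof.
move=> partP sYP; rewrite (_ : D :\: cover Y = cover (P :\: Y)).
  exact: sub_partition_cover partP (subsetDl _ _).
rewrite -(cover_partition partP); apply/setP=> x; rewrite inE.
apply/andP/bigcupP=> [[notYx /bigcupP[B PB Bx]]|[B /setDP[PB notYB] Bx]].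
  by exists B => //; rewrite inE PB andbT; apply: contra notYx => YB; apply/bigcupP; exists B.
split; last by apply/bigcupP; exists B.
apply: contra notYB => /bigcupP[C YC Cx].
by rewrite (partition_block_eq partP PB (subsetP sYP _ YC) Bx Cx).
Qed.

Lemma partition_setU Q Y D : partition Q D -> partition Y (cover Y) ->
  [disjoint D & cover Y] -> partition (Q :|: Y) (D :|: cover Y).
Proof.
move=> /and3P[/eqP coverQ tiQ Q0]; rewrite partition_coverE => /andP[tiY Y0] disDY.
rewrite /partition /cover bigcup_setU -/(cover Q) -/(cover Y) coverQ eqxx /=.
by rewrite trivIsetU ?coverQ // inE negb_or Q0.
Qed.

Lemma partition_card1 Q D : partition Q D -> #|Q| = 1 -> Q = [set D].
Proof.
move=> partQ /eqP/cards1P[B defQ]; rewrite defQ; congr [set _].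
by rewrite -(cover_partition partQ) defQ cover1.
Qed.

Lemma leq_card_cover_blocks Y : partition Y (cover Y) -> #|Y| <= #|cover Y|.
Proof.
move=> partY; rewrite (card_partition partY) -sum1_card; apply: leq_sum => B YB.
by rewrite card_gt0 (partition_neq0 partY).
Qed.

Lemma leq_card_cover_block Y B :
  partition Y (cover Y) -> B \in Y -> #|Y|.-1 + #|B| <= #|cover Y|.
Proof.
move=> partY YB; rewrite (card_partition partY) (bigD1 B) //= addnC leq_add2l.
rewrite -(cardsD1_mem YB) -sum1_card.
under [leqRHS]eq_bigl do rewrite andbC -in_setD1.
by apply: leq_sum => C /setD1P[_ YC]; rewrite card_gt0 (partition_neq0 partY).
Qed.

Definition singletons Y : bool := [forall B in Y, #|B| == 1].

Lemma singletonsP Y :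
  reflect (forall B, B \in Y -> exists x, B = [set x]) (singletons Y).
Proof.
by apply: (iffP forall_inP) => sY B /sY; [move/cards1P | case=> x ->; rewrite cards1].
Qed.

Lemma singletonsS Y Z : Y \subset Z -> singletons Z -> singletons Y.
Proof. by move=> /subsetP sYZ /forall_inP sZ; apply/forall_inP=> B /sYZ/sZ. Qed.

Lemma not_singletons_block Y : set0 \notin Y -> ~~ singletons Y ->
  exists2 B, B \in Y & 1 < #|B|.
Proof.
move=> Y0 /forall_inPn[B YB card_B]; exists B => //.
by rewrite ltn_neqAle eq_sym card_B card_gt0; apply: contraNneq Y0 => <-.
Qed.

Lemma singletons_partition Y : singletons Y -> partition Y (cover Y).
Proof.
move/singletonsP=> sY; rewrite partition_coverE; apply/andP; split.
  apply/trivIsetP=> _ _ /sY[x ->] /sY[y ->]; rewrite disjoints1 inE.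
  by apply: contra => /eqP->.
by apply/negP=> /sY[x /setP/(_ x)]; rewrite !inE eqxx.
Qed.

Lemma card_cover_singletons Y : singletons Y -> #|cover Y| = #|Y|.
Proof.
move=> sY; rewrite (card_partition (singletons_partition sY)) -sum1_card.
by apply: eq_bigr => B /(forall_inP sY)/eqP.
Qed.

End Blocks.

Section UnionBounds.
Variables I J : finType.
Implicit Types (A : {set J}) (D : {set I}) (B : I -> {set J}).

Lemma leq_card_bigcup D B : #|\bigcup_(i in D) B i| <= \sum_(i in D) #|B i|.
Proof.
elim/big_rec2: _ => [|i m A _ leA]; first by rewrite cards0.
by apply: leq_trans (leq_card_setU _ _) _; rewrite leq_add2l.
Qed.

Lemma leq_card_covered A D B :
  (forall x, x \in A -> exists2 i, i \in D & x \in B i) ->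
  #|A| <= \sum_(i in D) #|B i|.
Proof.
move=> covA; apply: leq_trans (leq_card_bigcup D B).
by apply/subset_leq_card/subsetP=> x /covA[i Di Bx]; apply/bigcupP; exists i.
Qed.

Lemma leq_card_covered_mul A D B c :
  (forall x, x \in A -> exists2 i, i \in D & x \in B i) ->
  (forall i, i \in D -> #|B i| <= c) -> #|A| <= #|D| * c.
Proof.
move=> covA leB; rewrite -sum_nat_const.
by apply: leq_trans (leq_card_covered covA) _; apply: leq_sum.
Qed.

Lemma sum_card_exchange (P : pred I) B :
  \sum_(i | P i) #|B i| = \sum_x #|[set i | P i & x \in B i]|.
Proof.
under eq_bigr do rewrite -sum1_card.
rewrite (exchange_big_dep predT) //=; apply: eq_bigr => x _.
by rewrite sum1dep_card.
Qed.

End UnionBounds.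

Lemma leq_bonferroni (I J : finType) (D : {set I}) (B : I -> {set J}) :
  \sum_(i in D) #|B i| <= #|\bigcup_(i in D) B i|
    + \sum_(W : {set I} | (W \subset D) && (#|W| == 2)) #|\bigcap_(i in W) B i|.
Proof.
rewrite sum_card_exchange [X in _ + X]sum_card_exchange.
rewrite -[#|\bigcup_(i in D) B i|]sum1_card.
rewrite [X in X + _]big_mkcond -big_split /=.
apply: leq_sum => x _.
set Dx := [set i | i \in D & x \in B i].
have -> : #|[set W : {set I} | (W \subset D) && (#|W| == 2) & x \in \bigcap_(i in W) B i]|
    = 'C(#|Dx|, 2).
  rewrite -cards_draws; apply: eq_card => W; rewrite !inE andbAC; congr (_ && _).
  apply/andP/subsetP=> [[/subsetP sWD /bigcapP Wx] i Wi|sWDx].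
    by rewrite inE sWD // Wx.
  split; first by apply/subsetP=> i /sWDx; rewrite inE => /andP[].
  by apply/bigcapP=> i /sWDx; rewrite inE => /andP[].
have -> : (x \in \bigcup_(i in D) B i) = (0 < #|Dx|).
  rewrite card_gt0; apply/bigcupP/set0Pn=> [[i Di Bx]|[i]]; last first.
    by rewrite inE => /andP[]; exists i.
  by exists i; rewrite inE Di.
by case: #|Dx| => [|[|m]] //=; rewrite binS bin1; lia.
Qed.

Lemma leq_bonferroni_uniform (I J : finType) (D : {set I}) (B : I -> {set J})
    (A : {set J}) c d :
  (forall i, i \in D -> B i \subset A) -> (forall i, i \in D -> c <= #|B i|) ->
  (forall i j, i \in D -> j \in D -> i != j -> #|B i :&: B j| <= d) ->
  #|D| * c <= #|A| + 'C(#|D|, 2) * d.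
Proof.
move=> sBA le_c le_d; rewrite -sum_nat_const.
apply: (@leq_trans (\sum_(i in D) #|B i|)); first exact: leq_sum.
apply: leq_trans (leq_bonferroni D B) _.
rewrite leq_add //; first exact/subset_leq_card/bigcupsP.
rewrite -cards_draws -sum_nat_const big_set /=; apply: leq_sum => W /andP[/subsetP sWD].
case/cards2P=> i [j [neq_ij defW]]; apply: leq_trans (le_d i j _ _ neq_ij); last first.
- by apply: sWD; rewrite defW set22.
- by apply: sWD; rewrite defW set21.
by rewrite subset_leq_card // subsetI !bigcap_inf // defW ?set21 ?set22.
Qed.

(** * Partitions with prescribed blocks *)

Definition star_size (n k s : nat) : nat := stirling2 (n - s) (k - s).

Section PrescribedBlocks.
Variable n : nat.
Implicit Types (P Q Y : spart n) (B : block n).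

Lemma CfamP k Y P :
  reflect [/\ partition P setT, #|P| = k & Y \subset P] (P \in Cfam n k Y).
Proof.
rewrite !inE /is_kpart -andbA.
by apply: (iffP and3P) => -[? /eqP ? ?].
Qed.

Lemma card_Cfam k Y : partition Y (cover Y) -> #|Y| <= k ->
  #|Cfam n k Y| = stirling2 (n - #|cover Y|) (k - #|Y|).
Proof.
move=> partY leYk.
have -> : n - #|cover Y| = #|~: cover Y| by rewrite [#|~: _|]cardsCs setCK card_ord.
rewrite -card_kpartitions.
have disjQY Q j : Q \in kpartitions (~: cover Y) j -> [disjoint Q & Y].
  case/kpartitionsP=> partQ _; apply/pred0P=> B; apply/negP=> /= /andP[QB YB].
  have /set0Pn[x Bx] := partition_neq0 partQ QB.
  have := subsetP (partitionS partQ QB) x Bx; rewrite inE => /negP; apply.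
  by apply/bigcupP; exists B.
have setUYK Q j : Q \in kpartitions (~: cover Y) j -> (Q :|: Y) :\: Y = Q.
  by move/disjQY=> disQ; rewrite setDUl setDv setU0; apply/setDidPl.
rewrite -[RHS](card_in_imset (f := fun Q => Q :|: Y)); last first.
  by move=> Q1 Q2 /setUYK{2}<- /setUYK{2}<- ->.
apply: eq_card => P; apply/CfamP/imsetP => [[partP cardP sYP]|[Q kQ ->]].
  exists (P :\: Y); last by rewrite setUC -[LHS](setID P Y) (setIidPr sYP).
  apply/kpartitionsP; split; first by rewrite -setTD partition_setD.
  by rewrite cardsD (setIidPr sYP) cardP.
have [partQ cardQ] := kpartitionsP _ _ _ kQ; split; last exact: subsetUr.
  have -> : [set: 'I_n] = ~: cover Y :|: cover Y by rewrite setUC setUCr.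
  by apply: partition_setU; rewrite // disjoints_subset.
by rewrite cardsU (disjoint_setI0 (disjQY _ _ kQ)) cards0 cardQ subn0 subnK.
Qed.

Lemma leq_card_Cfam_cover k Y j u : #|Y| = j -> j < k ->
  (partition Y (cover Y) -> u <= #|cover Y|) ->
  #|Cfam n k Y| <= stirling2 (n - u) (k - j).
Proof.
move=> cardY lt_jk le_u; have [->|[P /CfamP[partP _ sYP]]] := set_0Vmem (Cfam n k Y).
  by rewrite cards0.
have partY := sub_partition_cover partP sYP.
rewrite card_Cfam // cardY ?(ltnW lt_jk) // leq_stirling2 ?subn_gt0 //.
by rewrite leq_sub2l // le_u.
Qed.

Lemma leq_card_Cfam k Y j : #|Y| = j -> j < k -> #|Cfam n k Y| <= star_size n k j.
Proof.
move=> cardY lt_jk; apply: leq_card_Cfam_cover => // partY.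
by rewrite -cardY leq_card_cover_blocks.
Qed.

Lemma leq_card_Cfam_block k Y B j : #|Y| = j -> j < k -> B \in Y -> 1 < #|B| ->
  #|Cfam n k Y| <= stirling2 (n - j.+1) (k - j).
Proof.
move=> cardY lt_jk YB B_gt1; apply: leq_card_Cfam_cover => // partY.
apply: leq_trans (leq_card_cover_block partY YB).
by rewrite -cardY -(cardsD1_mem YB) -addn2 leq_add2l.
Qed.

Lemma card_Cfam_singletons k Y j : singletons Y -> #|Y| = j -> j <= k ->
  #|Cfam n k Y| = star_size n k j.
Proof.
move=> sY cardY le_jk; rewrite card_Cfam ?singletons_partition ?cardY //.
by rewrite card_cover_singletons ?cardY.
Qed.

End PrescribedBlocks.

(** * The threshold on [n] *)

Lemma INR_expn a b : INR (a ^ b) = pow (INR a) b.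
Proof. by elim: b => // b IHb; rewrite expnS mult_INR IHb. Qed.

Lemma leq_of_ln a b : 0 < a -> 0 < b -> Rle (ln (INR a)) (ln (INR b)) -> a <= b.
Proof.
move=> a_gt0 b_gt0; rewrite leqNgt => le_ln; apply/negP=> lt_ba.
have : Rlt (ln (INR b)) (ln (INR a)).
  by apply: ln_increasing; [apply: lt_0_INR | apply: lt_INR]; apply/ltP.
lra.
Qed.

Lemma pow_threshold n t k : Rle (Rmult (INR 2) (L k t)) (INR n) ->
  4 ^ (t + 1) * ((t + 1) * (k - t + 1)) ^ (2 * (k - t + 1)) <= 2 ^ n.
Proof.
set N := (t + 1) * (k - t + 1); set c := k - t + 1 => le_n.
have N_gt0 : 0 < N by rewrite /N !addn1.
have INR_N_gt0 : Rlt 0 (INR N) by apply: lt_0_INR; apply/ltP.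
have INR2_gt0 : Rlt 0 (INR 2) by apply: lt_0_INR; apply/ltP.
have ln2_gt0 : Rlt 0 (ln (INR 2)) by rewrite -ln_1; apply: ln_increasing; simpl; lra.
apply: leq_of_ln; rewrite ?muln_gt0 ?expn_gt0 ?N_gt0 //.
rewrite -[4]/(2 ^ 2) -expnM mult_INR !INR_expn ln_mult; try exact: pow_lt.
rewrite !ln_pow // (mult_INR 2 (t + 1)) (mult_INR 2 c).
have := Rmult_le_compat_r _ _ _ (Rlt_le _ _ ln2_gt0) le_n.
rewrite /L -/c -/N; apply: Rle_trans; right.
by field; lra.
Qed.

Lemma second_order_bernoulli q m :
  (2 * q ^ 2 + 2 * m * q + m * m.-1) * q ^ m <= 2 * q ^ 2 * q.+1 ^ m.
Proof.
elim: m => [|m IHm]; first by rewrite !muln0 !mul0n !addn0.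
rewrite [q.+1 ^ _]expnS mulnCA; apply: leq_trans (leq_mul (leqnn q.+1) IHm).
rewrite [q ^ m.+1]expnS mulnA [leqRHS]mulnA leq_mul2r; apply/orP; right.
by rewrite -mulnn; case: m {IHm} => [|m] /=; nia.
Qed.

Lemma double_pow_self q : 0 < q -> 2 * q ^ q <= 1 * q.+1 ^ q.
Proof.
move=> q_gt0; rewrite mul1n -(leq_pmul2l (m := 2 * q ^ 2)) ?muln_gt0 ?expn_gt0 ?q_gt0 //.
apply: leq_trans (second_order_bernoulli q q).
by rewrite mulnA leq_mul2r -mulnn; apply/orP; right; nia.
Qed.

Lemma nine_quarters_pow_self q : 1 < q -> 9 * q ^ q <= 4 * q.+1 ^ q.
Proof.
move=> q_gt1; rewrite -(leq_pmul2l (m := q ^ 2)) ?expn_gt0 ?(ltnW q_gt1) //.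
rewrite (_ : q ^ 2 * (4 * _) = 2 * (2 * q ^ 2 * q.+1 ^ q)); last by lia.
apply: leq_trans (leq_mul (leqnn 2) (second_order_bernoulli q q)).
by rewrite !mulnA leq_mul2r -mulnn; apply/orP; right; nia.
Qed.

Lemma pow_ratio_of_root a b M q d : 0 < b -> 0 < q ->
  a * q ^ q <= b * q.+1 ^ q -> b ^ d * M ^ q <= a ^ d -> M * q ^ d <= q.+1 ^ d.
Proof.
move=> b_gt0 q_gt0 le_ratio le_M.
rewrite -(@leq_exp2r _ _ q) // expnMn -(leq_pmul2l (m := b ^ d)) ?expn_gt0 ?b_gt0 //.
rewrite mulnA -[(q ^ d) ^ q]expnAC -[(q.+1 ^ d) ^ q]expnAC.
apply: leq_trans (leq_mul le_M (leqnn _)) _; rewrite -!expnMn.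
exact: leq_wexp2r.
Qed.

Lemma pow_ratio_anti M q r d : 0 < q -> q <= r ->
  M * r ^ d <= r.+1 ^ d -> M * q ^ d <= q.+1 ^ d.
Proof.
move=> q_gt0 le_qr le_r; have r_gt0 : 0 < r := leq_trans q_gt0 le_qr.
rewrite -(leq_pmul2r (m := r ^ d)) ?expn_gt0 ?r_gt0 // mulnAC.
apply: leq_trans (leq_mul le_r (leqnn _)) _; rewrite -!expnMn.
by rewrite leq_wexp2r // mulSn [leqRHS]mulSn mulnC leq_add2r.
Qed.

(* The consequences of [n >= 2 L(k1, t)] for an index [k <= k1], with
   [N = (t + 1) * (k1 - t + 1)]. *)
Record large_ground n t N k : Prop := LargeGround {
  lg_t_gt0 : 0 < t;
  lg_index : t.+2 <= k;
  lg_scale : (t + 1) * (k - t + 1) <= N;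
  lg_ground : k < n;
  lg_pow : 4 ^ (t + 1) * N ^ 6 <= 2 ^ n;
  lg_decay : forall s, t <= s -> s.+2 <= k ->
    N ^ 2 * star_size n k s.+1 <= star_size n k s;
  lg_last : N ^ 4 <= star_size n k k.-2
}.

Section Threshold.
Variables n t K : nat.
Hypotheses (t_gt0 : 0 < t) (K_gt1 : 1 < K).
Let N := (t + 1) * (K + 1).
Hypothesis le_threshold : 4 ^ (t + 1) * N ^ (2 * (K + 1)) <= 2 ^ n.

Let N_gt0 : 0 < N. Proof. by lia. Qed.

Lemma index_lt_ground : K + t < n.
Proof.
rewrite -(ltn_exp2l (m := 2)) //; apply: leq_trans le_threshold.
apply: leq_trans (_ : 4 ^ (t + 1) * 4 ^ (K + 1) <= _); last first.
  by rewrite leq_mul2l [N ^ _]expnM leq_exp2r ?orbT; nia.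
by rewrite -expnD -[4]/(2 ^ 2) -expnM ltn_exp2l //; lia.
Qed.

Local Notation d := (n - (K + t)).

Lemma pow_threshold_gap : 2 ^ (t + 2) * N ^ (2 * (K + 1)) <= 2 ^ d * 2 ^ K.
Proof.
rewrite -(leq_pmul2l (m := 2 ^ t)) ?expn_gt0 // mulnA -!expnD.
have -> : t + (d + K) = n by have := index_lt_ground; lia.
apply: leq_trans le_threshold; rewrite -[4]/(2 ^ 2) -expnM leq_mul2r leq_exp2l //.
by apply/orP; right; lia.
Qed.

Lemma expn_le_pow_gap c e : c + e = 2 * (K + 1) -> 2 ^ K <= 2 ^ (t + 2) * N ^ e ->
  N ^ c <= 2 ^ d.
Proof.
move=> def_exp le_e; rewrite -(leq_pmul2r (m := 2 ^ K)) ?expn_gt0 //.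
apply: leq_trans pow_threshold_gap; rewrite -def_exp (expnD N) mulnCA.
by rewrite leq_mul2l le_e orbT.
Qed.

Lemma expn4_le_pow_gap : N ^ 4 <= 2 ^ d.
Proof.
apply: (@expn_le_pow_gap 4 (2 * (K - 1))); first by lia.
apply: leq_trans (leq_pmull _ _); last by rewrite expn_gt0.
apply: leq_trans (_ : 2 ^ (2 * (K - 1)) <= _); first by rewrite leq_exp2l //; lia.
by rewrite leq_exp2r; lia.
Qed.

Lemma six_index_le_gap : 4 < K -> 6 * K <= d.
Proof.
move=> K_gt4; rewrite -(leq_exp2l (m := 2)) //.
rewrite -(leq_pmul2r (m := 2 ^ K)) ?expn_gt0 //; apply: leq_trans pow_threshold_gap.
apply: leq_trans (leq_pmull _ _); last by rewrite expn_gt0.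
apply: leq_trans (_ : (2 ^ 7) ^ (K + 1) <= _).
  by rewrite -expnM -expnD leq_exp2l //; lia.
rewrite expnM leq_exp2r; last by lia.
by apply: leq_trans (_ : 12 ^ 2 <= _) => //; rewrite leq_exp2r // /N; nia.
Qed.

(* [(1 + 1/q) ^ q] is at least [2], which suffices for small indices, and at least
   [9/4] from [q = 2] on, which compensates the factor [2 ^ K] for large ones. *)
Lemma pow_ratio_top : N ^ 2 * K.-1 ^ d <= K ^ d.
Proof.
pose q := K.-1; have defK : K = q.+1 by rewrite /q; lia.
have q_gt0 : 0 < q by lia.
rewrite -/q [X in _ <= X ^ _]defK; have [K_le4|K_gt4] := leqP K 4.
  apply: (pow_ratio_of_root (a := 2) (b := 1)) => //; first exact: double_pow_self.
  rewrite exp1n mul1n -expnM; apply: (expn_le_pow_gap (e := 4)); first by lia.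
  apply: leq_trans (leq_pmull _ _); last by rewrite expn_gt0.
  by apply: leq_trans (_ : 2 ^ 4 <= _); [rewrite leq_exp2l | rewrite leq_exp2r; lia].
apply: (pow_ratio_of_root (a := 9) (b := 4)) => //.
  by apply: nine_quarters_pow_self; lia.
have le_eights : 8 ^ d * 2 ^ K <= 9 ^ d.
  rewrite -(subnK (six_index_le_gap K_gt4)) !(expnD _ _ (6 * K)) -mulnA leq_mul //.
    exact: leq_wexp2r.
  by rewrite !expnM -expnMn; apply: leq_wexp2r; lia.
apply: leq_trans le_eights; rewrite -[8]/(4 * 2) expnMn -mulnA leq_mul2l.
apply/orP; right; apply: leq_trans pow_threshold_gap.
apply: leq_trans (leq_pmull _ _); last by rewrite expn_gt0.
by rewrite -expnM leq_exp2l //; lia.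
Qed.

Lemma pow_ratio q : 0 < q < K -> N ^ 2 * q ^ d <= q.+1 ^ d.
Proof.
case/andP=> q_gt0 lt_qK; apply: (pow_ratio_anti (r := K.-1)) => //; first by lia.
by rewrite prednK ?pow_ratio_top //; lia.
Qed.

Lemma star_size_decay k s : t <= s -> s.+2 <= k -> k <= K + t ->
  N ^ 2 * star_size n k s.+1 <= star_size n k s.
Proof.
move=> le_ts le_sk le_kK; have lt_n := index_lt_ground.
have [j def_j] : exists j, k - s = j.+2 by exists (k - s).-2; lia.
have [e def_n] : exists e, n - k = d + e by exists (K + t - k); lia.
have := stirling2_ratio (n - k) j; rewrite /star_size def_j.
have -> : j.+1 + (n - k) = n - s.+1 by lia.
have -> : j.+2 + (n - k) = n - s by lia.
have -> : k - s.+1 = j.+1 by lia.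
move=> le_ratio; rewrite -(leq_pmul2l (m := j.+1 ^ (n - k))) ?expn_gt0 //.
apply: leq_trans le_ratio; rewrite mulnCA mulnA leq_mul2r; apply/orP; right.
rewrite def_n !expnD mulnA leq_mul //; first by apply: pow_ratio; lia.
exact: leq_wexp2r.
Qed.

Lemma large_ground_of_pow k : t.+2 <= k <= K + t -> large_ground n t N k.
Proof.
case/andP=> le_tk le_kK; have lt_n := index_lt_ground; split=> //.
- by rewrite /N leq_mul2l; apply/orP; right; lia.
- exact: leq_ltn_trans lt_n.
- by apply: leq_trans le_threshold; rewrite leq_mul2l leq_exp2l ?orbT; lia.
- by move=> s le_ts le_sk; apply: star_size_decay.
rewrite /star_size; have -> : n - k.-2 = (n - k).+2 by lia.
have -> : k - k.-2 = 2 by lia.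
rewrite stirling2_Sn2 [2 ^ _]expnS; have le_d : 2 ^ d <= 2 ^ (n - k) by rewrite leq_exp2l //; lia.
by have := expn4_le_pow_gap; have := expn_gt0 2 d; lia.
Qed.

End Threshold.

Lemma large_ground_of_threshold n t k1 k : 0 < t -> t.+2 <= k <= k1 ->
  Rle (Rmult (INR 2) (L k1 t)) (INR n) ->
  large_ground n t ((t + 1) * (k1 - t + 1)) k.
Proof.
move=> t_gt0 /andP[le_tk le_kk1] /pow_threshold le_threshold.
by apply: large_ground_of_pow => //; lia.
Qed.

Section StarSizes.
Variables n t N k : nat.
Hypothesis lg : large_ground n t N k.

Let t_gt0 : 0 < t. Proof. exact: lg_t_gt0 lg. Qed.
Let le_tk : t.+2 <= k. Proof. exact: lg_index lg. Qed.
Let lt_kn : k < n. Proof. exact: lg_ground lg. Qed.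
Let scale : (t + 1) * (k - t + 1) <= N. Proof. exact: lg_scale lg. Qed.

Lemma lg_N_gt5 : 5 < N. Proof. by nia. Qed.

Lemma lg_N_ge_t : 3 * (t + 1) <= N. Proof. by nia. Qed.

Lemma lg_N_ge_index : 2 * (k - t + 1) <= N. Proof. by nia. Qed.

Lemma star_size_gt0 s : s < k -> 0 < star_size n k s.
Proof. by move=> lt_sk; apply: stirling2_gt0; lia. Qed.

Lemma star_size_pred : star_size n k k.-1 = 1.
Proof.
rewrite /star_size; have -> : k - k.-1 = 1 by lia.
have -> : n - k.-1 = (n - k).+1 by lia.
exact: stirling2_Sn1.
Qed.

Lemma star_size_t_decay : N ^ 2 * star_size n k t.+1 <= star_size n k t.
Proof. by apply: (lg_decay lg); rewrite ?leqnn. Qed.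

(* For [k = t.+2] the left-hand side vanishes, so the bound needs no decay. *)
Lemma star_size_t1_decay : N ^ 2 * star_size n k t.+2 <= star_size n k t.+1.
Proof.
have [k_ge|k_le] := ltnP t.+2 k; first by apply: (lg_decay lg); rewrite ?leqnSn.
rewrite {1}/star_size; have -> : k - t.+2 = 0 by lia.
by have -> : n - t.+2 = (n - t.+3).+1; [lia | rewrite stirling2_Sn0 muln0].
Qed.

Lemma leq_sqr_star_size_t : N ^ 2 <= star_size n k t.
Proof.
by apply: leq_trans star_size_t_decay; rewrite leq_pmulr // star_size_gt0.
Qed.

Lemma t_le_star_size_t : 36 * t <= star_size n k t.
Proof.
apply: leq_trans leq_sqr_star_size_t; rewrite -mulnn.
by apply: leq_trans (leq_mul lg_N_ge_t lg_N_ge_t); nia.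
Qed.

Lemma index_t_le_star_size_t : 6 * ((k - t) * t) <= star_size n k t.
Proof.
apply: leq_trans leq_sqr_star_size_t; rewrite -mulnn.
by apply: leq_trans (leq_mul lg_N_ge_index lg_N_ge_t); nia.
Qed.

Lemma double_star_size_shift : 2 * stirling2 (n - t.+1) (k - t) <= star_size n k t.
Proof.
rewrite /star_size (_ : n - t = (n - t.+1).+1); last by lia.
by apply: leq_trans (leq_mul_stirling2 _ _); rewrite leq_mul2r; apply/orP; right; lia.
Qed.

Lemma bin2_t_scale : 18 * 'C(t.+1, 2) <= N ^ 2.
Proof.
have := leq_mul lg_N_ge_t lg_N_ge_t; rewrite mulnn; apply: leq_trans.
by have := mul_bin_diag t.+1 1; rewrite bin1; nia.
Qed.

Lemma bin2_index_scale : 8 * 'C(k - t, 2) <= N ^ 2.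
Proof.
have := leq_mul lg_N_ge_index lg_N_ge_index; rewrite mulnn; apply: leq_trans.
by have := mul_bin_diag (k - t) 1; rewrite bin1; nia.
Qed.

End StarSizes.

(** * Covers and branching *)

Lemma exists_subset_card (T : finType) (A : {set T}) m :
  m <= #|A| -> exists2 W : {set T}, W \subset A & #|W| = m.
Proof.
rewrite -bin_gt0 -cards_draws card_gt0 => /set0Pn[W].
by rewrite inE => /andP[sWA /eqP cardW]; exists W.
Qed.

Lemma exists_subsetD1 (T : finType) (A B : {set T}) m : #|A| = m.+1 ->
  m <= #|A :&: B| -> exists2 x, x \in A & A :\ x \subset B.
Proof.
move=> cardA le_m; have [sAB|] := boolP (A \subset B).
  have /set0Pn[x Ax] : A != set0 by rewrite -card_gt0 cardA.
  by exists x; rewrite // (subset_trans (subD1set _ _)).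
case/subsetPn=> x Ax notBx; exists x => //.
have sub : A :&: B \subset A :\ x.
  by apply/subsetP=> y /setIP[Ay By]; rewrite !inE Ay andbT; apply: contraNneq notBx => <-.
have /eqP <- : A :&: B == A :\ x by rewrite eqEcard sub (cardsD1_succ cardA).
exact: subsetIr.
Qed.

Lemma leq_card_setU1I (T : finType) (A B : {set T}) x :
  #|(x |: A) :&: B| <= (x \in B) + #|A :&: B|.
Proof.
rewrite setIUl; apply: leq_trans (leq_card_setU _ _) _; rewrite leq_add2r.
have [Bx|notBx] := boolP (x \in B).
  by rewrite (leq_trans (subset_leq_card (subsetIl _ _))) ?cards1.
by rewrite leqn0 cards_eq0 setI_eq0 disjoints1.
Qed.

Lemma exists_transversal (T : finType) (F : {set {set T}}) (G Y : {set T}) t :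
  (forall P, P \in F -> t <= #|P :&: G|) -> #|Y :&: G| < t -> t <= #|G| ->
  exists W : {set T}, [/\ W \subset G :\: Y, #|W| = #|G| - t + 1
    & forall P, P \in F -> exists2 w, w \in W & w \in P].
Proof.
move=> tFG lt_YG le_tG; have [|W sWGY cardW] := @exists_subset_card _ (G :\: Y) (#|G| - t + 1).
  by rewrite cardsD setIC; lia.
exists W; split=> // P PF; apply/exists_inP; apply: contraLR (tFG _ PF).
move/exists_inPn=> disWP; rewrite -ltnNge.
have sWG : W \subset G by apply: subset_trans sWGY (subsetDl _ _).
apply: (@leq_ltn_trans #|G :\: W|); last by rewrite cardsD (setIidPr sWG) cardW; lia.
apply/subset_leq_card/subsetP=> B /setIP[PB GB]; rewrite inE GB andbT.
by apply: contraL PB => /disWP.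
Qed.

Section Covers.
Variables n t : nat.
Implicit Types (P G T Y Z : spart n) (F H : pfamily_of n).

Lemma PiP k P : reflect (partition P setT /\ #|P| = k) (P \in Pi n k).
Proof. by rewrite inE; apply: (iffP andP) => -[? /eqP]. Qed.

Lemma sub_Pi_partition k F P : F \subset Pi n k -> P \in F -> partition P setT.
Proof. by move=> /subsetP sF /sF/PiP[]. Qed.

Lemma sub_Pi_card k F P : F \subset Pi n k -> P \in F -> #|P| = k.
Proof. by move=> /subsetP sF /sF/PiP[]. Qed.

Definition through F Y : pfamily_of n := [set P in F | Y \subset P].

Lemma sub_through_Cfam k F Y : F \subset Pi n k -> through F Y \subset Cfam n k Y.
Proof. by move=> sF; apply/subsetP=> P /setIdP[/(subsetP sF)PiP sYP]; apply/setIdP. Qed.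

Lemma leq_card_through k F Y j : F \subset Pi n k -> #|Y| = j -> j < k ->
  #|through F Y| <= star_size n k j.
Proof.
move=> sF cardY lt_jk; apply: leq_trans (leq_card_Cfam cardY lt_jk).
exact/subset_leq_card/sub_through_Cfam.
Qed.

Definition tcover H T : bool := [forall G in H, t <= #|T :&: G|].

Lemma tcoverP H T : reflect (forall G, G \in H -> t <= #|T :&: G|) (tcover H T).
Proof. exact: forall_inP. Qed.

Lemma tcoverPn H T : reflect (exists2 G, G \in H & #|T :&: G| < t) (~~ tcover H T).
Proof. by apply: (iffP forall_inPn) => -[G GH lt_G]; exists G; rewrite ?ltnNge // -ltnNge. Qed.

Lemma leq_card_tcover H T : H != set0 -> tcover H T -> t <= #|T|.
Proof.
case/set0Pn=> G GH /tcoverP/(_ G GH)/leq_trans; apply.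
exact/subset_leq_card/subsetIl.
Qed.

Lemma tcover_subset H Z G : #|Z| = t -> tcover H Z -> G \in H -> Z \subset G.
Proof.
move=> cardZ /tcoverP covHZ GH; apply/setIidPl/eqP.
by rewrite eqEcard subsetIl cardZ covHZ.
Qed.

Lemma leq_card_by_tcover H T c : tcover H T ->
  (forall Z, Z \subset T -> #|Z| = t -> #|through H Z| <= c) ->
  #|H| <= 'C(#|T|, t) * c.
Proof.
move=> /tcoverP covHT leZ; rewrite -cards_draws.
apply: (leq_card_covered_mul (B := through H)) => [G GH|Z].
  have [Z sZTG cardZ] := exists_subset_card (covHT _ GH).
  exists Z; first by rewrite inE (subset_trans sZTG (subsetIl _ _)) cardZ eqxx.
  by rewrite inE GH (subset_trans sZTG (subsetIr _ _)).
by rewrite inE => /andP[sZT /eqP]; apply: leZ.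
Qed.

Lemma leq_card_by_tcover_star l H T : H \subset Pi n l -> t < l -> tcover H T ->
  #|H| <= 'C(#|T|, t) * star_size n l t.
Proof.
move=> sH lt_tl covHT; apply: leq_card_by_tcover => // Z _ cardZ.
exact: leq_card_through.
Qed.

Record cross_pair k l F H : Prop := CrossPair {
  cross_subl : F \subset Pi n k;
  cross_subr : H \subset Pi n l;
  crossP : cross_tint t F H
}.

Lemma cross_pair_sym k l F H : cross_pair k l F H -> cross_pair l k H F.
Proof. by case=> sF sH cr; split=> // P G PH GF; rewrite setIC; apply: cr. Qed.

Section Branching.
Variables (k l : nat) (F H : pfamily_of n).
Hypotheses (cp : cross_pair k l F H) (le_tl : t <= l).

Lemma tcover_member P : P \in F -> tcover H P.
Proof. by move=> PF; apply/tcoverP=> G; apply: (crossP cp). Qed.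

Lemma branch_step Y c : ~~ tcover H Y ->
  (forall w, w \notin Y -> #|through F (w |: Y)| <= c) ->
  #|through F Y| <= (l - t + 1) * c.
Proof.
move=> /tcoverPn[G GH lt_YG] le_c; have cardG := sub_Pi_card (cross_subr cp) GH.
have tFG P : P \in through F Y -> t <= #|P :&: G|.
  by case/setIdP=> PF _; apply: (crossP cp).
have [|W [sWGY cardW metW]] := exists_transversal tFG lt_YG; first by rewrite cardG.
rewrite -cardG -cardW.
apply: (leq_card_covered_mul (B := fun w => through F (w |: Y))) => [P PFY|w /(subsetP sWGY)].
  have [w Ww Pw] := metW _ PFY; exists w => //; have [PF sYP] := setIdP PFY.
  by rewrite inE PF subUset sub1set Pw.
by case/setDP=> _; apply: le_c.
Qed.

Lemma branch_bound m Y : m < k -> (forall T, tcover H T -> m <= #|T|) -> #|Y| <= m ->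
  #|through F Y| <= (l - t + 1) ^ (m - #|Y|) * star_size n k m.
Proof.
move=> lt_mk min_m le_Ym; move def_d: (m - #|Y|) => d.
elim: d Y def_d le_Ym => [|d IHd] Y def_d le_Ym.
  have -> : m = #|Y| by apply/eqP; rewrite eqn_leq le_Ym -subn_eq0 def_d.
  rewrite mul1n; apply: (leq_card_through (cross_subl cp)) => //.
  exact: leq_ltn_trans lt_mk.
have lt_Ym : #|Y| < m by rewrite -subn_gt0 def_d.
rewrite expnS -mulnA; apply: branch_step => [|w notYw].
  by apply/negP=> /min_m; rewrite leqNgt lt_Ym.
by apply: IHd; rewrite cardsU1 notYw // subnS def_d.
Qed.

Lemma exists_min_tcover : F != set0 -> H != set0 -> exists T,
  [/\ tcover H T, t <= #|T| <= k & forall T', tcover H T' -> #|T| <= #|T'|].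
Proof.
case/set0Pn=> P PF H_neq0; have covP := tcover_member PF.
case: (arg_minnP (fun T => #|T|) covP) => T covT minT; exists T; split=> //.
by rewrite (leq_card_tcover H_neq0 covT) -(sub_Pi_card (cross_subl cp) PF) minT.
Qed.

End Branching.
End Covers.

(* The parameter [c] is the number of branches at each step.  The truncation at
   [k.-1] is needed because [star_size n k k = 0], although one partition may contain
   [k] given blocks. *)
Definition branch_weight (n t k c m : nat) : nat :=
  c ^ (minn m k.-1 - t) * star_size n k (minn m k.-1).

Definition cover_weight (n t k c m : nat) : nat :=
  'C(m, t) * branch_weight n t k c m.

Lemma leq_binS m t : t <= m -> 'C(m.+1, t) <= (t + 1) * 'C(m, t).
Proof.
move=> le_tm; have := mul_bin_down m.+1 t => /= bin_down.
rewrite -(leq_pmul2l (m := m.+1 - t)) ?subn_gt0 // -bin_down mulnA leq_mul2r.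
by apply/orP; right; nia.
Qed.

Lemma cover_weightE n t k c m :
  m < k -> cover_weight n t k c m = 'C(m, t) * (c ^ (m - t) * star_size n k m).
Proof. by move=> lt_mk; rewrite /cover_weight /branch_weight (minn_idPl _) //; lia. Qed.

Lemma cover_weight_t n t k c : t < k -> cover_weight n t k c t = star_size n k t.
Proof. by move=> lt_tk; rewrite cover_weightE // binn subnn !mul1n. Qed.

Section CoverWeight.
Variables n t N k c : nat.
Hypotheses (lg : large_ground n t N k) (scale_c : (t + 1) * c <= N).
Local Notation W := (cover_weight n t k c).

Let le_tk : t.+2 <= k. Proof. exact: lg_index lg. Qed.
Let N_gt0 : 0 < N. Proof. exact: leq_ltn_trans (lg_N_gt5 lg). Qed.

Lemma cover_weight_t1 : W t.+1 <= N * star_size n k t.+1.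
Proof. by rewrite cover_weightE // binSn subSnn mulnA leq_mul2r -addn1 scale_c orbT. Qed.

Lemma cover_weight_step_of M m : t <= m -> m.+2 <= k ->
  N * M * star_size n k m.+1 <= star_size n k m -> M * W m.+1 <= W m.
Proof.
move=> le_tm lt_mk le_star; rewrite !cover_weightE; [|lia|lia].
rewrite -(leq_pmul2l N_gt0) subSn // expnS.
apply: leq_trans (_ : (t + 1) * c * ('C(m, t) * (c ^ (m - t) * star_size n k m)) <= _).
  apply: leq_trans (_ : (t + 1) * c *
    ('C(m, t) * (c ^ (m - t) * (N * M * star_size n k m.+1))) <= _).
    have := leq_mul (leq_binS le_tm) (leqnn (N * M * c * c ^ (m - t) * star_size n k m.+1)).
    by congr (_ <= _); lia.
  by rewrite !leq_mul2l le_star !orbT.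
by rewrite leq_mul2r scale_c orbT.
Qed.

Lemma cover_weight_step m : t <= m -> m.+2 <= k -> N * W m.+1 <= W m.
Proof. by move=> le_tm lt_mk; apply: cover_weight_step_of; rewrite // mulnn (lg_decay lg). Qed.

Lemma cover_weight_penultimate : N ^ 3 * W k.-1 <= W k.-2.
Proof.
have -> : k.-1 = k.-2.+1 by lia.
apply: cover_weight_step_of; [lia|lia|rewrite (_ : k.-2.+1 = k.-1); last by lia].
by rewrite (star_size_pred lg) muln1 -expnS (lg_last lg).
Qed.

Lemma cover_weight_top : W k <= (t + 1) * W k.-1.
Proof.
rewrite /cover_weight /branch_weight minnn (minn_idPr (leq_pred k)).
have le_bin : 'C(k, t) <= (t + 1) * 'C(k.-1, t).
  by rewrite -{1}[k]prednK ?leq_binS //; lia.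
by rewrite [leqRHS]mulnA leq_mul2r le_bin orbT.
Qed.

Lemma cover_weight_last m : k.-1 <= m <= k -> N ^ 2 * W m <= W k.-2.
Proof.
have le_tN : t + 1 <= N by have := lg_N_ge_t lg; lia.
case/andP=> ge_mk le_mk; apply: leq_trans cover_weight_penultimate.
have : W m <= N * W k.-1.
  have [lt_mk|ge_km] := ltnP m k.
    by rewrite (_ : m = k.-1) ?leq_pmull //; lia.
  rewrite (_ : m = k); last by lia.
  by apply: leq_trans cover_weight_top _; rewrite leq_mul2r le_tN orbT.
by rewrite [N ^ 3]expnSr -mulnA leq_mul2l => ->; rewrite orbT.
Qed.

Lemma cover_weight_decay_lt a m : t <= a -> a <= m -> m < k -> N ^ (m - a) * W m <= W a.
Proof.
move=> le_ta; elim: m => [|m IHm]; first by rewrite leqn0 => /eqP->; rewrite mul1n.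
rewrite leq_eqVlt => /predU1P[->|]; first by rewrite subnn mul1n.
rewrite ltnS => le_am lt_mk; apply: leq_trans (IHm le_am (ltnW lt_mk)).
rewrite subSn // expnSr -mulnA leq_mul2l.
by rewrite cover_weight_step ?orbT //; apply: leq_trans le_am.
Qed.

Lemma cover_weight_decay a m : t <= a -> a <= m <= k -> a.+2 <= k ->
  N ^ (m - a) * W m <= W a.
Proof.
move=> le_ta /andP[le_am le_mk] lt_ak; have [lt_mk|ge_mk] := ltnP m k.
  exact: cover_weight_decay_lt.
have -> : m - a = k.-2 - a + 2 by lia.
apply: leq_trans (cover_weight_decay_lt (m := k.-2) le_ta _ _); [|lia|lia].
by rewrite expnD -mulnA leq_mul2l cover_weight_last ?orbT //; lia.
Qed.

Lemma cover_weight_le_star_t1 m : t.+1 <= m <= k -> t.+3 <= k ->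
  N ^ (m - t.+1) * W m <= N * star_size n k t.+1.
Proof.
move=> le_m lt_tk; apply: leq_trans cover_weight_t1.
exact: cover_weight_decay.
Qed.

Lemma cover_weight_small m : k = t.+2 -> t.+1 <= m <= k ->
  W m <= N ^ 2 * star_size n k t.+1.
Proof.
move=> def_k /andP[ge_m le_m]; have le_tN : t + 1 <= N by have := lg_N_ge_t lg; lia.
have [le_mt|lt_tm] := leqP m t.+1.
  rewrite (_ : m = t.+1); last by lia.
  by apply: leq_trans cover_weight_t1 _; rewrite -mulnn -mulnA leq_pmull.
rewrite (_ : m = k); last by lia.
apply: leq_trans cover_weight_top _; rewrite (_ : k.-1 = t.+1); last by lia.
by rewrite -mulnn -mulnA leq_mul // cover_weight_t1.
Qed.

End CoverWeight.

Lemma leq_mul_trade M a b a1 b1 : a <= M * a1 -> M * b <= b1 -> a * b <= a1 * b1.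
Proof.
move=> le_a le_b; apply: leq_trans (leq_mul le_a (leqnn b)) _.
by rewrite mulnAC mulnC leq_mul2l le_b orbT.
Qed.

Lemma cover_weight_product n t N k l m1 m2 :
  large_ground n t N k -> large_ground n t N l -> l <= k ->
  t < m1 <= l -> t < m2 <= k ->
  cover_weight n t k (l - t + 1) m2 * cover_weight n t l (k - t + 1) m1
    <= star_size n k t.+1 * star_size n l t.
Proof.
move=> lgk lgl le_lk le_m1 le_m2; have [le_tk le_tl] := (lg_index lgk, lg_index lgl).
have [scale_k scale_l] := (lg_scale lgk, lg_scale lgl).
have [lt_tm1 le_m1l] := andP le_m1; have [lt_tm2 le_m2k] := andP le_m2.
have N_gt0 : 0 < N := leq_ltn_trans (leq0n 5) (lg_N_gt5 lgk).
have [lt_tk|le_kt] := ltnP t.+2 k.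
  apply: (leq_mul_trade (M := N)).
    apply: leq_trans (cover_weight_le_star_t1 lgk scale_l le_m2 lt_tk).
    by rewrite leq_pmull // expn_gt0 N_gt0.
  rewrite -(cover_weight_t n (k - t + 1) (ltnW le_tl)).
  have ge_m1 : t <= m1 <= l by rewrite ltnW.
  apply: leq_trans (cover_weight_decay lgl scale_k (leqnn t) ge_m1 le_tl).
  by rewrite leq_mul2r -{1}(expn1 N) leq_pexp2l ?subn_gt0 ?orbT.
apply: (leq_mul_trade (M := N ^ 2)).
  by apply: (cover_weight_small lgk scale_l) => //; lia.
have def_t : l.-2 = t by lia.
rewrite -(cover_weight_t n (k - t + 1) (ltnW le_tl)) -[X in _ <= cover_weight _ _ _ _ X]def_t.
by apply: (cover_weight_last lgl scale_k); lia.
Qed.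

Section CoverBounds.
Variables (n t N k l : nat) (F H : pfamily_of n).
Hypotheses (lgk : large_ground n t N k) (lgl : large_ground n t N l).
Hypothesis cp : cross_pair t k l F H.

Let le_tl : t <= l. Proof. exact: ltnW (ltnW (lg_index lgl)). Qed.

Lemma leq_card_branch_weight (T1 T2 : spart n) : tcover t F T1 ->
  (forall T, tcover t H T -> #|T2| <= #|T|) -> t <= #|T2| ->
  #|F| <= 'C(#|T1|, t) * branch_weight n t k (l - t + 1) #|T2|.
Proof.
move=> covT1 minT2 le_tT2; have le_tk := lg_index lgk.
apply: leq_card_by_tcover => // Z _ cardZ.
have := branch_bound cp le_tl (m := minn #|T2| k.-1) (Y := Z); rewrite cardZ; apply.
- by rewrite gtn_min prednK ?leqnn ?orbT //; apply: leq_trans le_tk.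
- by move=> T /minT2; apply: leq_trans; apply: geq_minl.
- by rewrite leq_min le_tT2 -ltnS prednK; [apply: ltnW | apply: leq_trans le_tk].
Qed.

End CoverBounds.

Section Balanced.
Variables (n t N k l : nat) (F H : pfamily_of n).
Hypotheses (lgk : large_ground n t N k) (lgl : large_ground n t N l).
Hypotheses (cp : cross_pair t k l F H) (F_neq0 : F != set0) (H_neq0 : H != set0).

Lemma unique_cover_bound (X : spart n) : #|X| = t -> tcover t F X -> t.+3 <= k ->
  (forall T, tcover t H T -> t.+2 <= #|T|) ->
  #|F| * #|H| <= star_size n k t.+1 * star_size n l t.
Proof.
move=> cardX covX lt_tk min_H; have lt_tl : t < l := ltnW (lg_index lgl).
have [T [covT /andP[le_tT le_Tk] minT]] := exists_min_tcover cp F_neq0 H_neq0.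
have := leq_card_branch_weight lgk lgl cp covX minT le_tT; rewrite cardX binn mul1n => leF.
have leH := leq_card_by_tcover_star (cross_subr cp) lt_tl covT.
apply: leq_trans (leq_mul leF leH) _; rewrite mulnA leq_mul2r; apply/orP; right.
rewrite mulnC -/(cover_weight _ _ _ _ _).
have N_gt0 : 0 < N := leq_ltn_trans (leq0n 5) (lg_N_gt5 lgk).
rewrite -(leq_pmul2l N_gt0).
have le_T : t.+1 <= #|T| <= k by rewrite le_Tk (ltnW (min_H _ covT)).
apply: leq_trans (cover_weight_le_star_t1 lgk (lg_scale lgl) le_T lt_tk).
rewrite leq_mul2r -{1}(expn1 N) leq_pexp2l ?orbT //.
by rewrite subn_gt0 min_H.
Qed.

Lemma balanced_bound : l <= k ->
  (forall T, tcover t F T -> t < #|T|) -> (forall T, tcover t H T -> t < #|T|) ->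
  #|F| * #|H| <= star_size n k t.+1 * star_size n l t.
Proof.
move=> le_lk min_F min_H.
have [T2 [covT2 /andP[le_tT2 le_T2k] minT2]] := exists_min_tcover cp F_neq0 H_neq0.
have [T1 [covT1 /andP[le_tT1 le_T1l] minT1]] :=
  exists_min_tcover (cross_pair_sym cp) H_neq0 F_neq0.
have leF := leq_card_branch_weight lgk lgl cp covT1 minT2 le_tT2.
have leH := leq_card_branch_weight lgl lgk (cross_pair_sym cp) covT2 minT1 le_tT1.
apply: leq_trans (leq_mul leF leH) _.
rewrite mulnACA ['C(_, _) * 'C(_, _)]mulnC -mulnACA.
apply: (cover_weight_product lgk lgl) => //.
  by rewrite min_F.
by rewrite min_H.
Qed.

End Balanced.

(** * The four constructions *)

Local Notation absorb M B := (M :\ B :|: [set B :|: ~: cover M]).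

Section Constructions.
Variable n : nat.
Implicit Types (P G T X Y M : spart n) (B : block n).

Lemma CfamS k X Y : X \subset Y -> Cfam n k Y \subset Cfam n k X.
Proof.
move=> sXY; apply/subsetP=> P /setIdP[kP sYP]; apply/setIdP.
by split=> //; apply: subset_trans sYP.
Qed.

Lemma CfamU k X Y : Cfam n k X :&: Cfam n k Y = Cfam n k (X :|: Y).
Proof. by apply/setP=> P; rewrite !inE subUset andbACA andbb. Qed.

Lemma Cfam_sub_Dfam l t T Y : Y \subset T -> t <= #|Y| -> Cfam n l Y \subset Dfam n l t T.
Proof.
move=> sYT le_tY; apply/subsetP=> P /setIdP[lP sYP]; apply/setIdP; split=> //.
by apply: leq_trans le_tY _; rewrite subset_leq_card // subsetI sYT.
Qed.

Lemma CD_cross_pair k l t T : cross_pair t k l (Cfam n k T) (Dfam n l t T).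
Proof.
split; try by apply/subsetP=> P /setIdP[].
move=> P G /setIdP[_ sTP] /setIdP[_ /leq_trans]; apply.
exact/subset_leq_card/setSI.
Qed.

Lemma absorb_partition M B : partition M (cover M) -> B \in M ->
  partition (absorb M B) setT /\ #|absorb M B| = #|M|.
Proof.
rewrite partition_coverE => /andP[tiM M0] MB.
set C := B :|: ~: cover M; have defC : C = ~: cover (M :\ B).
  by rewrite coverD1 // setCD setUC.
have C_neq0 : C != set0.
  apply: contraNneq M0 => C0; suff <- : B = set0 by [].
  by apply/eqP; rewrite -subset0 -C0 subsetUl.
have partMB : partition (M :\ B) (cover (M :\ B)).
  by rewrite partition_coverE trivIsetD // inE (negbTE M0) andbF.
have disC : [disjoint C & cover (M :\ B)] by rewrite defC disjoints_subset.
rewrite setUC; split.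
  rewrite (_ : setT = C :|: cover (M :\ B)); first exact: partitionU1.
  by rewrite defC setUC setUCr.
rewrite cardsU1 -(cardsD1_mem MB) (_ : C \notin _) //.
apply/negP=> MC; have /set0Pn[x Cx] := C_neq0.
by have := disjointFr disC Cx; rewrite (_ : x \in _) //; apply/bigcupP; exists C.
Qed.

Lemma AB_cross_pair k l t X M : partition M (cover M) -> #|M| = l ->
  X \subset M -> #|X| = t -> cross_pair t k l (Afam n k X M) (Bfam n l X M).
Proof.
move=> partM cardM sXM cardX; split; first by apply/subsetP=> P /setIdP[].
  apply/subsetP=> G /setUP[/setIdP[]//|/imsetP[B XB ->]].
  have [partB cardB] := absorb_partition partM (subsetP sXM _ XB).
  by apply/PiP; rewrite cardB.
move=> P G /setIdP[_ /andP[sXP /set0Pn[b /setIP[Pb /setDP[Mb notXb]]]]].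
case/setUP=> [/setIdP[_ sXG]|/imsetP[B XB ->]].
  by rewrite -cardX subset_leq_card // subsetI sXP.
have cardXB : #|b |: X :\ B| = t.
  by rewrite cardsU1 !inE (negbTE notXb) andbF -cardX -(cardsD1_mem XB).
rewrite -cardXB; apply/subset_leq_card/subsetP=> C /setU1P[->|/setD1P[neqCB XC]].
  rewrite !inE Pb Mb andbT /=; apply/orP; left.
  by apply: contraNneq notXb => ->.
by rewrite !inE (subsetP sXP) // neqCB (subsetP sXM).
Qed.

Section Sizes.
Variables t N k l : nat.
Hypotheses (lgk : large_ground n t N k) (lgl : large_ground n t N l).

Let le_tk : t.+2 <= k. Proof. exact: lg_index lgk. Qed.
Let le_tl : t.+2 <= l. Proof. exact: lg_index lgl. Qed.

Lemma common_block_Cfam Y B : singletons Y -> #|Y| = t ->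
  (forall G, G \in Cfam n l Y -> B \in G) -> B \in Y.
Proof.
move=> sY cardY commonB; apply: contraT => notYB.
have : #|Cfam n l Y| <= #|Cfam n l (B |: Y)|.
  apply/subset_leq_card/subsetP=> G GY; have GB := commonB _ GY.
  by move/setIdP: GY => [lG sYG]; apply/setIdP; rewrite subUset sub1set GB.
rewrite (card_Cfam_singletons sY cardY (ltnW (ltnW le_tl))) => le_size.
have cardBY : #|B |: Y| = t.+1 by rewrite cardsU1 notYB cardY.
have := leq_trans le_size (leq_card_Cfam cardBY le_tl).
apply: contraTT => _; rewrite -ltnNge.
apply: leq_trans (star_size_t_decay lgl).
rewrite -[X in X < _]mul1n ltn_pmul2r ?(star_size_gt0 lgl) //.
by apply: leq_trans (_ : 6 ^ 2 <= _) => //; rewrite leq_exp2r // (lg_N_gt5 lgl).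
Qed.

Lemma CD_nontrivial T : singletons T -> #|T| = t.+1 ->
  nontrivial t (Cfam n k T) (Dfam n l t T).
Proof.
move=> sT cardT; rewrite /nontrivial (_ : common_blocks _ _ = set0).
  by rewrite cards0 (lg_t_gt0 lgk).
apply/setP=> B; rewrite [RHS]inE; apply/negP; rewrite inE => /forall_inP commonB.
have in_tsubset Y : Y \subset T -> #|Y| = t -> B \in Y.
  move=> sYT cardY; apply: (common_block_Cfam _ cardY); first exact: singletonsS sT.
  move=> G YG; apply: commonB; apply/setUP; right.
  by apply: subsetP YG; rewrite Cfam_sub_Dfam ?cardY.
have [|Y sYT cardY] := @exists_subset_card _ T t; first by rewrite cardT.
have TB := subsetP sYT _ (in_tsubset _ sYT cardY).
have : B \in T :\ B by apply: in_tsubset; [exact: subD1set | exact: cardsD1_succ].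
by rewrite setD11.
Qed.

Lemma AB_nontrivial X M : singletons M -> #|M| = l -> X \subset M -> #|X| = t ->
  nontrivial t (Afam n k X M) (Bfam n l X M).
Proof.
move=> sM cardM sXM cardX; rewrite /nontrivial (_ : common_blocks _ _ = set0).
  by rewrite cards0 (lg_t_gt0 lgk).
apply/setP=> B; rewrite [RHS]inE; apply/negP; rewrite inE => /forall_inP commonB.
have XB : B \in X.
  apply: (common_block_Cfam _ cardX); first exact: singletonsS sM.
  by move=> G XG; apply: commonB; rewrite !in_setU XG orbT.
have : B \in absorb M B.
  by apply: commonB; rewrite !in_setU; apply/orP; right; apply/orP; right; apply/imsetP; exists B.
rewrite !inE eqxx /= => /eqP eqB.
have /set0Pn[x notMx] : ~: cover M != set0.
  rewrite -card_gt0 cardsCs setCK card_ord card_cover_singletons // cardM subn_gt0.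
  exact: lg_ground lgl.
move: (notMx); rewrite inE => /negP; apply; apply/bigcupP; exists B; first exact: (subsetP sXM).
by rewrite eqB inE notMx orbT.
Qed.

Lemma card_Dfam_ge T : singletons T -> #|T| = t.+1 ->
  t.+1 * star_size n l t <= #|Dfam n l t T| + 'C(t.+1, 2) * star_size n l t.+1.
Proof.
move=> sT cardT.
have cardTx x : x \in T -> #|T :\ x| = t := cardsD1_succ cardT.
have := @leq_bonferroni_uniform _ _ T (fun x => Cfam n l (T :\ x)); rewrite cardT; apply.
- by move=> x Tx; rewrite Cfam_sub_Dfam ?subD1set ?cardTx.
- move=> x Tx; have sTx := singletonsS (subD1set T x) sT.
  by rewrite (card_Cfam_singletons sTx (cardTx x Tx) (ltnW (ltnW le_tl))).
move=> x y Tx Ty neq_xy; rewrite CfamU -(card_Cfam_singletons sT cardT (ltnW le_tl)).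
apply/subset_leq_card/CfamS/subsetP=> B TB; rewrite !inE TB !andbT.
by case: (eqVneq B x) => [->|].
Qed.

Lemma card_Afam_ge X M : singletons M -> #|M| = l -> X \subset M -> #|X| = t ->
  (l - t) * star_size n k t.+1
    <= #|Afam n k X M| + 'C(l - t, 2) * star_size n k t.+2.
Proof.
move=> sM cardM sXM cardX.
have cardMX : #|M :\: X| = l - t by rewrite cardsD (setIidPr sXM) cardM cardX.
have sMU b : b \in M :\: X -> b |: X \subset M.
  by case/setDP=> Mb _; rewrite subUset sub1set Mb.
have cardU b : b \in M :\: X -> #|b |: X| = t.+1.
  by case/setDP=> _ notXb; rewrite cardsU1 notXb cardX.
have := @leq_bonferroni_uniform _ _ (M :\: X) (fun b => Cfam n k (b |: X)).
rewrite cardMX; apply.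
- move=> b MXb; apply/subsetP=> P /setIdP[kP]; rewrite subUset sub1set => /andP[Pb sXP].
  by apply/setIdP; split=> //; rewrite sXP; apply/set0Pn; exists b; rewrite inE Pb.
- move=> b MXb /=; rewrite (card_Cfam_singletons _ (cardU b MXb)) //; last exact: ltnW.
  exact: singletonsS (sMU _ MXb) sM.
move=> b c MXb MXc neq_bc; rewrite CfamU -setUA (setUCA X) setUid.
have cardbc : #|b |: (c |: X)| = t.+2.
  by rewrite cardsU1 cardU // !inE negb_or neq_bc; case/setDP: MXb => _ ->.
rewrite (card_Cfam_singletons _ cardbc) //; apply: singletonsS sM.
by rewrite subUset sMU // sub1set; case/setDP: MXb => ->.
Qed.

End Sizes.
End Constructions.

Lemma sing_singletons n s : singletons (sing n s).
Proof. by apply/singletonsP=> B /imsetP[x _ ->]; exists x. Qed.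

Lemma card_sing n s : s <= n -> #|sing n s| = s.
Proof.
move=> le_sn; rewrite card_imset; last exact: set1_inj.
have : \sum_(i < s) 1 = \sum_(i < n | i < s) 1 := big_ord_widen n (fun=> 1) le_sn.
rewrite sum1_card card_ord sum1dep_card => {2}->.
by apply: eq_card => i; rewrite !inE.
Qed.

Lemma sing_subset n s1 s2 : s1 <= s2 -> sing n s1 \subset sing n s2.
Proof.
move=> le_s; apply/subsetP=> _ /imsetP[x lt_x ->]; apply: imset_f.
by move: lt_x; rewrite !inE => /leq_trans; apply.
Qed.

(** * Optimal pairs *)

Record optimal_pair n t k l (F H : pfamily_of n) : Prop := OptimalPair {
  optimal_cross : cross_pair t k l F H;
  optimal_nontrivial : nontrivial t F H;
  optimal_max : forall F' H' : pfamily_of n, cross_pair t k l F' H' ->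
    nontrivial t F' H' -> #|F'| * #|H'| <= #|F| * #|H|
}.

Lemma nontrivial_sym n t (F H : pfamily_of n) : nontrivial t F H -> nontrivial t H F.
Proof. by rewrite /nontrivial /common_blocks setUC. Qed.

Lemma optimal_pair_sym n t k l (F H : pfamily_of n) :
  optimal_pair t k l F H -> optimal_pair t l k H F.
Proof.
case=> cp ntr max; split; [exact: cross_pair_sym | exact: nontrivial_sym |].
move=> F' H' cp' ntr'; rewrite mulnC [leqRHS]mulnC.
by apply: max; [apply: cross_pair_sym | apply: nontrivial_sym].
Qed.

Section OptimalSize.
Variables (n t N k l : nat) (F H : pfamily_of n).
Hypotheses (lgk : large_ground n t N k) (lgl : large_ground n t N l).
Hypothesis opt : optimal_pair t k l F H.

Local Notation p := (star_size n k t.+1).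
Local Notation s := (star_size n l t).

Lemma optimal_ge_CD : 18 * t.+1 * (p * s) <= 18 * (#|F| * #|H|) + p * s.
Proof.
have le_tk := lg_index lgk; have lt_kn := lg_ground lgk.
pose T := sing n t.+1; have sT : singletons T := sing_singletons _ _.
have cardT : #|T| = t.+1 by rewrite card_sing; lia.
have := optimal_max opt (CD_cross_pair k l t T) (CD_nontrivial lgk lgl sT cardT).
rewrite (card_Cfam_singletons sT cardT (ltnW le_tk)) => le_FH.
have le_D := card_Dfam_ge lgl sT cardT.
have le_small : 18 * ('C(t.+1, 2) * star_size n l t.+1) <= s.
  rewrite mulnA; apply: leq_trans (star_size_t_decay lgl).
  by rewrite leq_mul2r (bin2_t_scale lgl) orbT.
have := leq_mul (leqnn p) le_D; have := leq_mul (leqnn p) le_small.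
move: le_FH; clear; lia.
Qed.

Lemma optimal_ge_AB : 8 * (l - t) * (p * s) <= 8 * (#|F| * #|H|) + p * s.
Proof.
have le_tl := lg_index lgl; have lt_ln := lg_ground lgl.
pose X := sing n t; pose M := sing n l.
have sM : singletons M := sing_singletons _ _.
have cardM : #|M| = l by rewrite card_sing; lia.
have cardX : #|X| = t by rewrite card_sing; lia.
have sXM : X \subset M by apply: sing_subset; lia.
have := optimal_max opt (AB_cross_pair k (singletons_partition sM) cardM sXM cardX)
  (AB_nontrivial lgk lgl sM cardM sXM cardX).
have le_A := card_Afam_ge lgk sM cardM sXM cardX.
have le_B : s <= #|Bfam n l X M|.
  rewrite -(card_Cfam_singletons (singletonsS sXM sM) cardX (ltnW (ltnW le_tl))).
  exact/subset_leq_card/subsetUl.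
have le_small : 8 * ('C(l - t, 2) * star_size n k t.+2) <= p.
  rewrite mulnA; apply: leq_trans (star_size_t1_decay lgk).
  by rewrite leq_mul2r (bin2_index_scale lgl) orbT.
move=> le_FH; have := leq_mul le_A (leqnn s); have := leq_mul (leqnn #|Afam n k X M|) le_B.
have := leq_mul le_small (leqnn s); move: le_FH; clear; lia.
Qed.

Lemma star_product_gt0 : 0 < p * s.
Proof.
rewrite muln_gt0 (star_size_gt0 lgk (lg_index lgk)).
exact: (star_size_gt0 lgl (ltnW (lg_index lgl))).
Qed.

Lemma optimal_gt_balanced : p * s < #|F| * #|H|.
Proof.
have := optimal_ge_CD; have := star_product_gt0; have := lg_t_gt0 lgk.
by move: (p * s) (_ * _) => x y; nia.
Qed.

Lemma optimal_neq0 : F != set0 /\ H != set0.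
Proof.
have := leq_ltn_trans (leq0n _) optimal_gt_balanced.
by rewrite muln_gt0 !card_gt0 => /andP.
Qed.

(* One heavy block fewer than [l - t] costs about [p], more than the light blocks
   and the members avoiding [X] can recover. *)
Lemma intermediate_heavy_lt a f h : 0 < a < l - t ->
  f <= a * p + (l - t - a) * ((l - t + 1) * star_size n k t.+2) ->
  h <= s + t * ((k - t) * star_size n l t.+1) -> f * h < #|F| * #|H|.
Proof.
case/andP=> a_gt0 lt_a le_f le_h.
have le_N6 := lg_N_gt5 lgk; have le_c := lg_N_ge_index lgl.
have decay_p := star_size_t1_decay lgk; have decay_s := star_size_t_decay lgl.
have [e def_K] : exists e, l - t = a + e.+1 by exists (l - t - a).-1; lia.
rewrite def_K addKn in le_f le_c.
have le_f12 : 12 * f <= (12 * (a + e) + 1) * p.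
  have le_light : 12 * ((a + e.+1 + 1) * star_size n k t.+2) <= p.
    apply: leq_trans decay_p; rewrite mulnA leq_mul2r -mulnn; apply/orP; right.
    by apply: leq_trans (leq_mul le_N6 le_c); lia.
  by have := leq_mul (leqnn e.+1) le_light; move: le_f; clear; lia.
have le_hN : N * h <= (N + 1) * s.
  rewrite mulnDl mul1n; apply: leq_trans (leq_mul (leqnn N) le_h) _.
  rewrite mulnDr leq_add2l; apply: leq_trans decay_s.
  rewrite -mulnn -[N * N * _]mulnA leq_mul2l [t * _]mulnA leq_mul2r; apply/orP; right.
  by apply/orP; right; apply: leq_trans (lg_scale lgk); apply: leq_mul; lia.
have lt_coef : (12 * (a + e) + 1) * (N + 1) < N * (12 * (a + e) + 7) by clear -le_c; lia.
have lt_fh : 12 * (f * h) < (12 * (a + e) + 7) * (p * s).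
  rewrite -(ltn_pmul2l (m := N)) ?(leq_ltn_trans _ le_N6) // [N * (12 * _)]mulnCA.
  rewrite [N * (f * h)]mulnCA mulnA; apply: leq_ltn_trans (leq_mul le_f12 le_hN) _.
  by rewrite mulnACA [N * _]mulnA ltn_pmul2r // star_product_gt0.
have := optimal_ge_AB; rewrite def_K; move: lt_fh star_product_gt0; clear; lia.
Qed.

End OptimalSize.

(** * Families with [t] common blocks *)

Section TwoBlocks.
Variables (T : finType) (V : {set T}).
Implicit Types (b c : {set T}) (Q R G : {set {set T}}).

Lemma partition_card2 Q b : partition Q V -> #|Q| = 2 -> b \in Q -> Q = [set b; V :\: b].
Proof.
move=> partQ cardQ Qb; rewrite -(setD1K Qb) (partition_card1 (partitionD1 partQ Qb)) //.
exact: cardsD1_succ cardQ Qb.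
Qed.

Variables Q R : {set {set T}}.
Hypotheses (partQ : partition Q V) (cardQ : #|Q| = 2).
Hypotheses (partR : partition R V) (cardR : #|R| = 2) (neqQR : Q != R).

Let VDb b : b \in Q -> V :\: b \in Q.
Proof. by move=> Qb; rewrite (partition_card2 partQ cardQ Qb) set22. Qed.

Lemma two_blocks_disjoint G b c : trivIset G -> b \in Q -> b \in G ->
  c \in R -> c \in G -> [disjoint b & c].
Proof.
move=> /trivIsetP tiG Qb Gb Rc Gc; apply: tiG => //.
apply: contra neqQR => /eqP eq_bc; rewrite (partition_card2 partQ cardQ Qb) eq_bc.
by rewrite -(partition_card2 partR cardR Rc).
Qed.

Lemma two_blocks_complement_notin G b : trivIset G -> (exists2 c, c \in R & c \in G) ->
  b \in Q -> b \in G -> V :\: b \notin G.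
Proof.
move=> tiG [c Rc Gc] Qb Gb; apply/negP=> GVb; have /negP := partition_neq0 partR Rc; apply.
rewrite -(setIidPl (partitionS partR Rc)) -[V](setID _ b) setIUr setU_eq0 !setI_eq0.
rewrite disjoint_sym (disjointWl (subsetIr _ _)) ?(two_blocks_disjoint tiG Qb) //.
by rewrite disjoint_sym (two_blocks_disjoint tiG (VDb Qb)).
Qed.

Lemma two_blocks_stable G0 G b : trivIset G0 -> trivIset G ->
  (exists2 c, c \in R & c \in G0) -> (exists2 d, d \in Q & d \in G) ->
  (exists2 c, c \in R & c \in G) -> b \in Q -> b \in G0 -> b \in G.
Proof.
move=> tiG0 tiG [c Rc G0c] [d Qd Gd] [e Re Ge] Qb G0b.
have dis_bc := two_blocks_disjoint tiG0 Qb G0b Rc G0c.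
have /set2P[<- //|def_d] : d \in [set b; V :\: b] by rewrite -(partition_card2 partQ cardQ Qb).
have sub_eb : e \subset b.
  have := two_blocks_disjoint tiG Qd Gd Re Ge; rewrite def_d disjoint_sym disjoints_subset.
  rewrite setCD => sub_e; apply/subsetP=> x ex.
  by move: (subsetP (partitionS partR Re) x ex) (subsetP sub_e x ex); rewrite !inE => ->.
have /set2P[def_e|def_e] : e \in [set c; V :\: c] by rewrite -(partition_card2 partR cardR Rc).
  have /negP := partition_neq0 partR Re; case; rewrite -(setIidPr sub_eb) setI_eq0.
  by rewrite def_e.
case/eqP: neqQR; rewrite (partition_card2 partQ cardQ Qb) (_ : b = e).
  by rewrite (partition_card2 partR cardR Re).
apply/eqP; rewrite eqEsubset sub_eb andbT def_e subsetD (partitionS partQ Qb).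
exact: dis_bc.
Qed.

End TwoBlocks.

Section CommonBlocks.
Variables (n t N k l : nat) (F H : pfamily_of n) (X : spart n).
Implicit Types (P G R : spart n) (b c w x : block n).
Hypotheses (lgk : large_ground n t N k) (lgl : large_ground n t N l).
Hypotheses (cp : cross_pair t k l F H) (F_neq0 : F != set0).
Hypotheses (cardX : #|X| = t) (XF : forall P, P \in F -> X \subset P).
Hypothesis notcovX : ~~ tcover t H X.

Let sF : F \subset Pi n k. Proof. exact: cross_subl cp. Qed.
Let sH : H \subset Pi n l. Proof. exact: cross_subr cp. Qed.
Let le_tl : t <= l. Proof. exact: ltnW (ltnW (lg_index lgl)). Qed.

Definition heavy : {set block n} :=
  [set b | [&& b \notin X, tcover t H (b |: X) & through F (b |: X) != set0]].

Lemma heavyP b : reflect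
  [/\ b \notin X, tcover t H (b |: X) & exists2 P, P \in F & b \in P] (b \in heavy).
Proof.
rewrite inE; apply: (iffP and3P) => -[notXb covb]; last first.
  by case=> P PF Pb; split=> //; apply/set0Pn; exists P; rewrite inE PF subUset sub1set Pb XF.
by case/set0Pn=> P /setIdP[PF]; rewrite subUset sub1set => /andP[Pb _]; split=> //; exists P.
Qed.

Lemma card_capX_lt G : ~~ (X \subset G) -> #|X :&: G| < t.
Proof.
move=> notXG; rewrite -cardX proper_card // properEneq subsetIl andbT.
by apply: contra notXG => /eqP/setIidPl.
Qed.

Lemma exists_notsupX : exists2 G, G \in H & ~~ (X \subset G).
Proof.
have [G GH lt_XG] := tcoverPn _ _ _ notcovX; exists G => //.
by apply: contraL lt_XG => /setIidPl->; rewrite cardX ltnn.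
Qed.

Lemma meets_outsideX P G : P \in F -> G \in H -> ~~ (X \subset G) ->
  exists2 b, b \in P :\: X & b \in G.
Proof.
move=> PF GH notXG; have : ~~ (P :&: G \subset X :&: G).
  apply/negP=> /subset_leq_card; rewrite leqNgt.
  by rewrite (leq_trans (card_capX_lt notXG)) // (crossP cp).
case/subsetPn=> b /setIP[Pb Gb]; rewrite inE Gb andbT => notXb.
by exists b => //; rewrite inE notXb.
Qed.

Lemma tcover_notsupX G b : G \in H -> ~~ (X \subset G) -> tcover t H (b |: X) ->
  b \in G /\ exists x, [/\ x \in X, x \notin G & X :\ x \subset G].
Proof.
move=> GH notXG /tcoverP/(_ G GH) le_t.
have {le_t} le_t : t <= (b \in G) + #|X :&: G| := leq_trans le_t (leq_card_setU1I _ _ _).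
have Gb : b \in G.
  by move: le_t; case: (b \in G) => //; rewrite add0n leqNgt card_capX_lt.
have [y Xy notGy] := subsetPn notXG.
have [|x Xx sXxG] := exists_subsetD1 (esym (cardsD1_mem Xy)) (B := G).
  by rewrite -ltnS cardsD1_mem // cardX; rewrite Gb in le_t.
split=> //; exists x; split=> //; apply: contra notXG => Gx.
by rewrite -(setD1K Xx) subUset sub1set Gx.
Qed.

Lemma exists_block_avoiding G x : G \in H -> x \in X -> x \notin G ->
  exists c, [/\ c \in G, c \notin X & forall P, P \in F -> c \notin P].
Proof.
move=> GH Xx notGx; have [P0 P0F] := set0Pn _ F_neq0.
have partP P : P \in F -> partition P setT by apply: (sub_Pi_partition sF).
have partG := sub_Pi_partition sH GH.
have /set0Pn[y xy] := partition_neq0 (partP _ P0F) (subsetP (XF P0F) _ Xx).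
have Gy : y \in cover G by rewrite (cover_partition partG).
have notP P : P \in F -> pblock G y \notin P.
  move=> PF; apply: contra notGx => Py; rewrite (_ : x = pblock G y) ?pblock_mem //.
  by apply: (partition_block_eq (partP _ PF) (subsetP (XF PF) _ Xx) Py xy); rewrite mem_pblock.
exists (pblock G y); split=> //; first exact: pblock_mem.
by apply: contra (notP _ P0F); apply: subsetP; apply: XF.
Qed.

(* A block of [G] meeting the block of [X] missing from [G] lies in no member of
   [F], so one branch of the generic argument is lost. *)
Lemma heavy_transversal G b : G \in H -> ~~ (X \subset G) -> b \in heavy ->
  exists2 R : {set block n}, [/\ heavy \subset R, R \subset G :\: X & #|R| = l - t]
    & forall P, P \in F -> exists2 w, w \in R & w \in P.
Proof.
move=> GH notXG /heavyP[_ covb _].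
have [_ [x [Xx notGx sXG]]] := tcover_notsupX GH notXG covb.
have [c [Gc notXc notFc]] := exists_block_avoiding GH Xx notGx.
exists ((G :\: X) :\ c); last first.
  move=> P PF; have [w /setDP[Pw notXw] Gw] := meets_outsideX PF GH notXG.
  exists w; rewrite // !inE notXw Gw !andbT.
  by apply: contraTneq Pw => ->; apply: notFc.
split; [|exact: subD1set|].
  apply/subsetP=> d /heavyP[notXd covd [P PF Pd]].
  rewrite !inE notXd (tcover_notsupX GH notXG covd).1 !andbT.
  by apply: contraTneq Pd => ->; apply: notFc.
have defGX : G :&: X = X :\ x.
  apply/setP=> B; rewrite !inE; case: eqVneq => [->|neqBx] /=; first by rewrite (negbTE notGx).
  by apply: andb_idl => XB; apply: (subsetP sXG); rewrite !inE neqBx.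
have GXc : c \in G :\: X by rewrite inE notXc.
have := cardsD1_mem GXc; rewrite (cardsD G X) defGX (sub_Pi_card sH GH).
move: #|X :\ x| #|_ :\ c| (cardsD1_mem Xx) le_tl => m r; rewrite cardX.
by clear; lia.
Qed.

Lemma leq_card_light w : t.+3 <= k -> w \notin X -> w \notin heavy ->
  #|through F (w |: X)| <= (l - t + 1) * star_size n k t.+2.
Proof.
move=> lt_tk notXw; rewrite inE notXw /= negb_and negbK.
case/orP=> [notcov|/eqP->]; last by rewrite cards0.
apply: (branch_step cp le_tl notcov) => v notXwv.
have card_v : #|v |: (w |: X)| = t.+2 by rewrite cardsU1 notXwv cardsU1 notXw cardX.
exact: leq_card_through sF card_v lt_tk.
Qed.

Section SmallIndex.
Hypotheses (def_k : k = t.+2) (F_gt1 : 1 < #|F|).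
Let V := setT :\: cover X.

Lemma partition_outsideX P : P \in F -> partition (P :\: X) V /\ #|P :\: X| = 2.
Proof.
move=> PF; split; first exact: partition_setD (sub_Pi_partition sF PF) (XF PF).
by rewrite cardsD (setIidPr (XF PF)) (sub_Pi_card sF PF) cardX def_k -addn2 addKn.
Qed.

Lemma outsideX_inj P P' : P \in F -> P' \in F -> P != P' -> P :\: X != P' :\: X.
Proof.
move=> PF P'F; apply: contra => /eqP eqD.
by rewrite -(setID P X) -(setID P' X) (setIidPr (XF PF)) (setIidPr (XF P'F)) eqD.
Qed.

Lemma exists_heavy_of_small P : P \in F -> exists2 b, b \in heavy & b \in P.
Proof.
move=> PF; have [P' P'F neqP] : exists2 P', P' \in F & P != P'.
  have : 0 < #|F :\ P| by rewrite -ltnS (cardsD1_mem PF).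
  by rewrite card_gt0 => /set0Pn[P' /setD1P[neqP P'F]]; exists P'; rewrite // eq_sym.
have [[partQ cardQ] [partR cardR]] := (partition_outsideX PF, partition_outsideX P'F).
have neqQ := outsideX_inj PF P'F neqP.
have tiH G : G \in H -> trivIset G.
  by move=> GH; apply: partition_trivIset (sub_Pi_partition sH GH).
have [G0 G0H notXG0] := exists_notsupX.
have [b Qb G0b] := meets_outsideX PF G0H notXG0; have [Pb notXb] := setDP Qb.
exists b => //; apply/heavyP; split=> //; last by exists P.
apply/tcoverP=> G GH; have [sXG|notXG] := boolP (X \subset G).
  by rewrite -cardX subset_leq_card // subsetI subsetUr.
have [metQ metR] := (meets_outsideX PF GH notXG, meets_outsideX P'F GH notXG).
have Gb : b \in G.
  apply: (two_blocks_stable partQ cardQ partR cardR neqQ (tiH _ G0H) (tiH _ GH)) => //.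
  exact: meets_outsideX.
have notGVb := two_blocks_complement_notin partQ cardQ partR cardR neqQ (tiH _ GH) metR Qb Gb.
apply: leq_trans (crossP cp PF GH) _; apply/subset_leq_card/subsetP=> B /setIP[PB GB].
rewrite !inE GB andbT orbC; have [//|notXB] := boolP (B \in X).
have : B \in P :\: X by rewrite inE notXB.
rewrite (partition_card2 partQ cardQ Qb) => /set2P[->|defB]; first exact: eqxx.
by rewrite -defB GB in notGVb.
Qed.

End SmallIndex.

Section NonDegenerate.
Hypothesis nondeg : t.+3 <= k \/ 1 < #|F|.

Lemma large_index_or_heavy P : P \in F -> t.+3 <= k \/ exists2 b, b \in heavy & b \in P.
Proof.
move=> PF; have [lt_tk|le_kt] := ltnP t.+2 k; [by left | right].
case: nondeg => [|F_gt1]; first by rewrite ltnNge le_kt.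
apply: exists_heavy_of_small => //; apply/eqP.
by rewrite eqn_leq le_kt (lg_index lgk).
Qed.

Lemma leq_card_heavy : heavy != set0 -> #|heavy| <= l - t.
Proof.
case/set0Pn=> b heavyb; have [G GH notXG] := exists_notsupX.
have [R [sR _ <-] _] := heavy_transversal GH notXG heavyb.
exact: subset_leq_card.
Qed.

Lemma leq_card_F_heavy : heavy != set0 ->
  #|F| <= #|heavy| * star_size n k t.+1
    + (l - t - #|heavy|) * ((l - t + 1) * star_size n k t.+2).
Proof.
case/set0Pn=> b heavyb; have [G GH notXG] := exists_notsupX.
have [R [sR sRG cardR] metR] := heavy_transversal GH notXG heavyb.
have through_w w P : P \in F -> w \in P -> P \in through F (w |: X).
  by move=> PF Pw; rewrite inE PF subUset sub1set Pw XF.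
pose hit := [set P in F | [exists d in heavy, d \in P]].
rewrite -(cardsID hit F) leq_add //.
  apply: (leq_card_covered_mul (B := fun d => through F (d |: X))) => [P|d /heavyP[notXd _ _]].
    by rewrite !inE => /and3P[PF _ /exists_inP[d heavyd Pd]]; exists d; rewrite ?through_w.
  have card_d : #|d |: X| = t.+1 by rewrite cardsU1 notXd cardX.
  exact: leq_card_through sF card_d (lg_index lgk).
have hitE P : P \in F :\: hit -> P \in F /\ forall d, d \in heavy -> d \notin P.
  by case/setDP=> PF; rewrite inE PF => /exists_inPn.
have -> : l - t - #|heavy| = #|R :\: heavy| by rewrite cardsD (setIidPr sR) cardR.
have [lt_tk|le_kt] := ltnP t.+2 k; last first.
  rewrite (_ : F :\: hit = set0) ?cards0 //; apply/setP=> P; rewrite [RHS]inE.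
  apply/negP=> /hitE[PF nohit]; have [|[d heavyd Pd]] := large_index_or_heavy PF.
    by rewrite ltnNge le_kt.
  by have := nohit d heavyd; rewrite Pd.
apply: (leq_card_covered_mul (B := fun w => through F (w |: X))) => [P /hitE[PF nohit]|w].
  have [w Rw Pw] := metR _ PF; exists w; last exact: through_w.
  by rewrite inE Rw andbT; apply: contraL Pw => /nohit.
case/setDP=> Rw notheavy; apply: leq_card_light => //.
by have /setDP[] := subsetP sRG _ Rw.
Qed.

Lemma leq_card_F_light : heavy = set0 ->
  t.+3 <= k /\ #|F| <= (l - t + 1) * ((l - t + 1) * star_size n k t.+2).
Proof.
move=> heavy0; have [P PF] := set0Pn _ F_neq0.
have [lt_tk|[b]] := large_index_or_heavy PF; last by rewrite heavy0 inE.
split=> //; have <- : through F X = F.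
  by apply/setP=> Q; rewrite inE; apply: andb_idr; apply: XF.
apply: (branch_step cp le_tl notcovX) => w notXw.
by apply: leq_card_light; rewrite // heavy0 inE.
Qed.

Lemma leq_card_H_heavy b P : b \in heavy -> P \in F -> b \notin P ->
  #|H| <= star_size n l t + t * ((k - t) * star_size n l t.+1).
Proof.
move=> /heavyP[notXb covb _] PF notPb.
rewrite -(cardsID (through H X) H) leq_add //.
  apply: leq_trans (subset_leq_card (subsetIr _ _)) _.
  exact: leq_card_through sH cardX (ltnW (lg_index lgl)).
have cardPX : #|P :\: X| = k - t.
  by rewrite cardsD (setIidPr (XF PF)) (sub_Pi_card sF PF) cardX.
rewrite -[X in X * _]cardX -cardPX.
pose through_triple x f := through H (f |: (b |: X :\ x)).
apply: (leq_card_covered_mul (B := fun x => \bigcup_(f in P :\: X) through_triple x f)) => [G|x Xx].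
  case/setDP=> GH; rewrite inE GH => notXG.
  have [Gb [x [Xx notGx sXG]]] := tcover_notsupX GH notXG covb.
  have [f Pf Gf] := meets_outsideX PF GH notXG; exists x => //; apply/bigcupP; exists f => //.
  by rewrite inE GH !subUset !sub1set Gf Gb.
apply: (leq_card_covered_mul (B := through_triple x)) => [G /bigcupP[f Pf Gf]|f]; first by exists f.
case/setDP=> Pf notXf; have neq_fb : f != b by apply: contraNneq notPb => <-.
have card_fb : #|f |: (b |: X :\ x)| = t.+1.
  rewrite !cardsU1 !inE (negbTE neq_fb) (negbTE notXf) (negbTE notXb) !andbF /=.
  by rewrite -cardX -(cardsD1_mem Xx).
exact: leq_card_through sH card_fb (lg_index lgl).
Qed.

End NonDegenerate.
End CommonBlocks.

Definition CD_form n t k l (F H : pfamily_of n) : Prop := exists T : spart n,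
  [/\ #|T| = t.+1, F = Cfam n k T & H = Dfam n l t T].

Definition AB_form n t k l (F H : pfamily_of n) : Prop := exists X M : spart n,
  [/\ X \subset M, #|X| = t, #|M| = l & partition M (cover M)] /\
  (F = Afam n k X M /\ H = Bfam n l X M).

Lemma leq_mul_squeeze a b a' b' : 0 < a -> 0 < b -> a <= a' -> b <= b' ->
  a' * b' <= a * b -> a' <= a /\ b' <= b.
Proof. by move=> *; split; nia. Qed.

Section OptimalForms.
Variables (n t N k l : nat) (F H : pfamily_of n).
Implicit Types (P G T X M : spart n) (b x : block n).
Hypotheses (lgk : large_ground n t N k) (lgl : large_ground n t N l).
Hypothesis opt : optimal_pair t k l F H.

Let cp : cross_pair t k l F H. Proof. exact: optimal_cross opt. Qed.
Let F_neq0 : F != set0. Proof. by case: (optimal_neq0 lgk lgl opt). Qed.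
Let H_neq0 : H != set0. Proof. by case: (optimal_neq0 lgk lgl opt). Qed.

Lemma optimal_maximal (F' H' : pfamily_of n) : F \subset F' -> H \subset H' ->
  cross_pair t k l F' H' -> F = F' /\ H = H'.
Proof.
move=> sFF' sHH' cp'.
have ntr' : nontrivial t F' H'.
  apply: leq_ltn_trans (optimal_nontrivial opt); apply/subset_leq_card/subsetP=> B.
  rewrite !inE => /forall_inP commonB; apply/forall_inP=> P PFH; apply: commonB.
  by apply: subsetP PFH; apply: setUSS.
have [le_F le_H] : #|F'| <= #|F| /\ #|H'| <= #|H|.
  apply: leq_mul_squeeze (optimal_max opt cp' ntr');
    by rewrite ?card_gt0 ?subset_leq_card.
by split; apply/eqP; rewrite eqEcard ?sFF' ?sHH'.
Qed.

Lemma optimal_notcover X : #|X| = t -> tcover t F X -> ~~ tcover t H X.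
Proof.
move=> cardX covF; apply/negP=> covH; have := optimal_nontrivial opt.
rewrite /nontrivial -cardX ltnNge => /negP; apply; apply/subset_leq_card/subsetP=> B XB.
rewrite inE; apply/forall_inP=> P.
by case/setUP=> [/(tcover_subset cardX covF)|/(tcover_subset cardX covH)] /subsetP; apply.
Qed.

Lemma CD_form_of_cover T : #|T| = t.+1 -> (forall P, P \in F -> T \subset P) ->
  tcover t H T -> CD_form t k l F H.
Proof.
move=> cardT TF /tcoverP covT; exists T.
have [||<- <-] := optimal_maximal _ _ (CD_cross_pair k l t T); last by split.
  by apply/subsetP=> P PF; apply/setIdP; rewrite (subsetP (cross_subl cp)) // TF.
by apply/subsetP=> G GH; apply/setIdP; rewrite (subsetP (cross_subr cp)) // covT.
Qed.

Section CommonSet.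
Variable X : spart n.
Hypotheses (cardX : #|X| = t) (covX : tcover t F X).
Hypothesis nondeg : t.+3 <= k \/ 1 < #|F|.

Let XF P : P \in F -> X \subset P. Proof. exact: (tcover_subset cardX covX). Qed.
Let notcovX : ~~ tcover t H X. Proof. exact: optimal_notcover. Qed.

Local Notation heavy := (heavy t F H X).

Lemma optimal_heavy_neq0 : heavy != set0.
Proof.
apply/eqP=> heavy0; have := optimal_gt_balanced lgk lgl opt; rewrite ltnNge => /negP; apply.
have [lt_tk leF] := leq_card_F_light lgk lgl cp F_neq0 cardX XF notcovX nondeg heavy0.
have [/existsP[T /andP[covT le_T]]|noT] :=
    boolP [exists T : spart n, tcover t H T && (#|T| <= t.+1)]; last first.
  apply: (unique_cover_bound lgk lgl cp F_neq0 H_neq0 cardX covX lt_tk) => T covT.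
  by rewrite ltnNge; apply: contra noT => le_T; apply/existsP; exists T; rewrite covT.
have leH : #|H| <= t.+1 * star_size n l t.
  apply: leq_trans (leq_card_by_tcover_star (cross_subr cp) _ covT) _.
    exact: ltnW (lg_index lgl).
  by rewrite leq_mul2r -binSn leq_bin2l ?orbT.
apply: leq_trans (leq_mul leF leH) _; rewrite mulnA leq_mul2r; apply/orP; right.
apply: leq_trans (star_size_t1_decay lgk).
have le_c : l - t + 1 <= N by apply: leq_trans (lg_scale lgl); rewrite leq_pmull // addn1.
rewrite -mulnn; have := leq_mul (leq_mul (lg_scale lgl) le_c) (leqnn (star_size n k t.+2)).
by clear; lia.
Qed.

Section FullHeavy.
Hypothesis card_heavy : #|heavy| = l - t.
Let M := X :|: heavy.
Let heavyP := heavyP t H XF.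

Let heavy_sub_notsupX G b : G \in H -> ~~ (X \subset G) -> b \in heavy -> b \in G.
Proof.
move=> GH notXG /heavyP[_ covb _].
by case: (tcover_notsupX cardX GH notXG covb).
Qed.

Lemma card_full_heavy : #|M| = l.
Proof.
rewrite cardsU cardX card_heavy (_ : X :&: heavy = set0) ?cards0 ?subn0 ?subnKC //.
  exact: ltnW (ltnW (lg_index lgl)).
apply/setP=> b; rewrite !inE; apply/negP=> /and3P[Xb].
by rewrite Xb.
Qed.

Lemma partition_full_heavy : partition M (cover M).
Proof.
have common b1 b2 : b1 \in M -> b2 \in M -> exists P, [/\ partition P setT, b1 \in P & b2 \in P].
  have [P0 P0F] := set0Pn _ F_neq0; have partF P : P \in F -> partition P setT.
    exact: (sub_Pi_partition (cross_subl cp)).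
  case/setUP=> [Xb1|heavy1] /setUP[Xb2|heavy2].
  - by exists P0; split; [exact: partF | exact: (subsetP (XF P0F)) ..].
  - have [_ _ [P PF Pb]] := heavyP _ heavy2.
    by exists P; split=> //; [exact: partF | exact: (subsetP (XF PF))].
  - have [_ _ [P PF Pb]] := heavyP _ heavy1.
    by exists P; split=> //; [exact: partF | exact: (subsetP (XF PF))].
  have [G GH notXG] := exists_notsupX cardX notcovX.
  by exists G; split; [exact: (sub_Pi_partition (cross_subr cp)) | exact: heavy_sub_notsupX ..].
rewrite partition_coverE; apply/andP; split.
  apply/trivIsetP=> b1 b2 Mb1 Mb2; have [P [partP Pb1 Pb2]] := common _ _ Mb1 Mb2.
  exact: (trivIsetP (partition_trivIset partP)).
by apply/negP=> M0; have [P [partP P0 _]] := common _ _ M0 M0; rewrite (partition0 partP) in P0.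
Qed.

Let sXM : X \subset M. Proof. exact: subsetUl. Qed.

Lemma full_heavy_sub_Afam : F \subset Afam n k X M.
Proof.
have [G GH notXG] := exists_notsupX cardX notcovX.
have [b heavyb] := set0Pn _ optimal_heavy_neq0.
apply/subsetP=> P PF; apply/setIdP; rewrite (subsetP (cross_subl cp)) // XF //=.
split=> //; have [R [sR _ cardR] metR] :=
  heavy_transversal lgl cp F_neq0 cardX XF GH notXG heavyb.
have defR : heavy = R by apply/eqP; rewrite eqEcard sR cardR card_heavy /=.
have [w] := metR _ PF; rewrite -defR => heavyw Pw; have [notXw _ _] := heavyP _ heavyw.
by apply/set0Pn; exists w; rewrite in_setI Pw in_setD notXw in_setU heavyw orbT.
Qed.

Lemma full_heavy_sub_Bfam : H \subset Bfam n l X M.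
Proof.
have [partM cardM] := (partition_full_heavy, card_full_heavy).
have [b heavyb] := set0Pn _ optimal_heavy_neq0; have [_ covb _] := heavyP _ heavyb.
apply/subsetP=> G GH; have [sXG|notXG] := boolP (X \subset G).
  by apply/setUP; left; apply/setIdP; rewrite (subsetP (cross_subr cp)).
have [_ [x [Xx notGx sXG]]] := tcover_notsupX cardX GH notXG covb.
have Mx : x \in M by apply: (subsetP sXM).
have sMG : M :\ x \subset G.
  apply/subsetP=> B /setD1P[neqBx /setUP[XB|]]; last exact: heavy_sub_notsupX.
  by apply: (subsetP sXG); rewrite !inE neqBx.
have defG : G :\: (M :\ x) = [set setT :\: cover (M :\ x)].
  apply: partition_card1.
    exact: partition_setD (sub_Pi_partition (cross_subr cp) GH) sMG.
  rewrite cardsD (setIidPr sMG) (sub_Pi_card (cross_subr cp) GH) -cardM.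
  by rewrite -(cardsD1_mem Mx) subSnn.
apply/setUP; right; apply/imsetP; exists x => //.
rewrite -{1}(setID G (M :\ x)) (setIidPr sMG) defG setTD coverD1 ?setCD ?(setUC _ x) //.
exact: partition_trivIset partM.
Qed.

Lemma AB_form_of_full_heavy : AB_form t k l F H.
Proof.
have [partM cardM] := (partition_full_heavy, card_full_heavy).
exists X, M; split=> //; apply: optimal_maximal; last exact: AB_cross_pair.
  exact: full_heavy_sub_Afam.
exact: full_heavy_sub_Bfam.
Qed.

End FullHeavy.

Lemma CD_or_AB_form_of_common_blocks : CD_form t k l F H \/ AB_form t k l F H.
Proof.
have heavyP := heavyP t H XF; have heavy_neq0 := optimal_heavy_neq0.
have [/exists_inP[b heavyb /forall_inP Fb]|/exists_inPn nocommon] :=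
    boolP [exists b in heavy, [forall P in F, b \in P]].
  left; have [notXb covb _] := heavyP _ heavyb; apply: CD_form_of_cover covb.
    by rewrite cardsU1 notXb cardX.
  by move=> P PF; rewrite subUset sub1set Fb // XF.
right; have [b heavyb] := set0Pn _ heavy_neq0.
have [P PF notPb] : exists2 P, P \in F & b \notin P by apply/forall_inPn/nocommon.
have := leq_card_heavy lgl cp F_neq0 cardX XF notcovX heavy_neq0.
rewrite leq_eqVlt => /predU1P[|lt_heavy]; first exact: AB_form_of_full_heavy.
have leF := leq_card_F_heavy lgk lgl cp F_neq0 cardX XF notcovX nondeg heavy_neq0.
have leH := leq_card_H_heavy lgl cp cardX XF heavyb PF notPb.
have := intermediate_heavy_lt lgk lgl opt _ leF leH.
by rewrite card_gt0 heavy_neq0 lt_heavy ltnn => /(_ isT).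
Qed.

End CommonSet.
End OptimalForms.

(** * The prescribed blocks are singletons *)

Section UpperSizes.
Variables n t N k l : nat.
Implicit Types (T X M : spart n) (b c : block n).
Hypotheses (lgk : large_ground n t N k) (lgl : large_ground n t N l).

Local Notation p := (star_size n k t.+1).
Local Notation s := (star_size n l t).

Lemma leq_card_Dfam_block T c : #|T| = t.+1 -> c \in T -> 1 < #|c| ->
  2 * #|Dfam n l t T| <= (t + 2) * s.
Proof.
move=> cardT Tc c_gt1; have lt_tl : t < l := ltnW (lg_index lgl).
have cardTx x : x \in T -> #|T :\ x| = t := cardsD1_succ cardT.
apply: (@leq_trans (2 * (s + t * stirling2 (n - t.+1) (l - t)))); last first.
  by have := leq_mul (leqnn t) (double_star_size_shift lgl); clear; lia.
rewrite leq_mul2l /=; apply: (@leq_trans (\sum_(x in T) #|Cfam n l (T :\ x)|)).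
  apply: leq_card_covered => G /setIdP[lG /(exists_subsetD1 cardT)[x Tx sTxG]].
  by exists x => //; apply/setIdP.
rewrite (big_setD1 c) //= leq_add //.
  exact: leq_card_Cfam (cardTx c Tc) lt_tl.
rewrite -(cardTx _ Tc) -sum_nat_const; apply: leq_sum => x /setD1P[neq_xc Tx].
rewrite cardTx //; apply: (leq_card_Cfam_block (cardTx x Tx) lt_tl _ c_gt1).
by rewrite !inE eq_sym neq_xc.
Qed.

Lemma leq_card_Bfam X M : #|Bfam n l X M| <= #|Cfam n l X| + #|X|.
Proof.
by apply: leq_trans (leq_card_setU _ _) _; rewrite leq_add2l leq_imset_card.
Qed.

Lemma leq_card_Afam_sum X M :
  #|Afam n k X M| <= \sum_(b in M :\: X) #|Cfam n k (b |: X)|.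
Proof.
apply: leq_card_covered => P /setIdP[kP /andP[sXP /set0Pn[b /setIP[Pb Mb]]]].
by exists b => //; apply/setIdP; rewrite subUset sub1set Pb.
Qed.

Lemma leq_card_Cfam_U1 X b : #|X| = t -> b \notin X -> #|Cfam n k (b |: X)| <= p.
Proof.
move=> cardX notXb; apply: leq_card_Cfam (lg_index lgk).
by rewrite cardsU1 notXb cardX.
Qed.

Lemma leq_card_Afam X M : X \subset M -> #|X| = t -> #|M| = l ->
  #|Afam n k X M| <= (l - t) * p.
Proof.
move=> sXM cardX cardM; apply: leq_trans (leq_card_Afam_sum X M) _.
have <- : #|M :\: X| = l - t by rewrite cardsD (setIidPr sXM) cardX cardM.
by rewrite -sum_nat_const; apply: leq_sum => b /setDP[_ notXb]; apply: leq_card_Cfam_U1.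
Qed.

Lemma leq_card_Afam_block X M c : X \subset M -> #|X| = t -> #|M| = l ->
  c \in M :\: X -> 1 < #|c| -> t.+3 <= k -> 2 * #|Afam n k X M| + p <= 2 * (l - t) * p.
Proof.
move=> sXM cardX cardM MXc c_gt1 lt_tk; have [Mc notXc] := setDP MXc.
have card_rest : #|M :\: X :\ c|.+1 = l - t.
  by rewrite -cardX -cardM -[in RHS](setIidPr sXM) -cardsD; apply: cardsD1_mem.
have card_c : #|c |: X| = t.+1 by rewrite cardsU1 notXc cardX.
have le_c : 2 * #|Cfam n k (c |: X)| <= p.
  apply: leq_trans (_ : 2 * stirling2 (n - t.+2) (k - t.+1) <= _).
    rewrite leq_mul2l /=.
    exact: leq_card_Cfam_block card_c (lg_index lgk) (setU11 c X) c_gt1.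
  rewrite /star_size (_ : n - t.+1 = (n - t.+2).+1); last first.
    by rewrite -subSn // (leq_trans (lg_index lgk)) // ltnW ?(lg_ground lgk).
  apply: leq_trans (leq_mul_stirling2 _ _); rewrite leq_mul2r ltn_subRL addn1 lt_tk.
  by rewrite orbT.
have le_rest : \sum_(b in M :\: X :\ c) #|Cfam n k (b |: X)| <= #|M :\: X :\ c| * p.
  rewrite -sum_nat_const; apply: leq_sum => b /setD1P[_ /setDP[_ notXb]].
  exact: leq_card_Cfam_U1.
have := leq_card_Afam_sum X M; rewrite (big_setD1 c) //= -card_rest.
move: le_c le_rest; move: #|Cfam _ _ _| #|_ :\ c| (\sum_(_ in _) _) => C m S.
by clear; lia.
Qed.

End UpperSizes.

Section OptimalSingletons.
Variables (n t N k l : nat) (F H : pfamily_of n).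
Implicit Types (T X M : spart n).
Hypotheses (lgk : large_ground n t N k) (lgl : large_ground n t N l).
Hypothesis opt : optimal_pair t k l F H.

Local Notation p := (star_size n k t.+1).
Local Notation s := (star_size n l t).

Lemma optimal_CD_singletons T : #|T| = t.+1 -> F = Cfam n k T -> H = Dfam n l t T ->
  singletons T.
Proof.
move=> cardT defF defH; apply: contraT => notsT.
have [/set0Pn[P PF] _] := optimal_neq0 lgk lgl opt.
have /CfamP[partP _ sTP] : P \in Cfam n k T by rewrite -defF.
have T0 : set0 \notin T by rewrite (partition0 (sub_partition_cover partP sTP)).
have [c Tc c_gt1] := not_singletons_block T0 notsT.
have leH : 2 * #|H| <= (t + 2) * s by rewrite defH; apply: (leq_card_Dfam_block lgl cardT Tc).
have leF : #|F| <= p by rewrite defF; apply: leq_card_Cfam cardT (lg_index lgk).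
have := optimal_ge_CD lgk lgl opt; have := star_product_gt0 lgk lgl.
have := leq_mul leF leH; have := lg_t_gt0 lgk.
rewrite mulnCA [p * (_ * _)]mulnCA; move: (p * s) (#|F| * #|H|) => ps FH.
by clear; nia.
Qed.

(* When [k = t.+2], [star_size n k t.+1 = 1] whatever the sizes of the blocks, so
   the blocks of [M] outside [X] leave no trace in the product. *)
Lemma optimal_AB_singletons_or_tie X M : X \subset M -> #|X| = t -> #|M| = l ->
  partition M (cover M) -> F = Afam n k X M -> H = Bfam n l X M ->
  singletons M \/ k = t.+2 /\ #|F| * #|H| <= (l - t) * (s + t).
Proof.
move=> sXM cardX cardM partM defF defH.
have [|notsM] := boolP (singletons M); [by left | right].
have M0 : set0 \notin M by rewrite (partition0 partM).
have [c Mc c_gt1] := not_singletons_block M0 notsM.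
have lt_tl : t < l := ltnW (lg_index lgl).
have K_gt0 : 0 < l - t by rewrite subn_gt0.
have leF : #|F| <= (l - t) * p by rewrite defF; apply: (leq_card_Afam lgk).
have ge_FH := optimal_ge_AB lgk lgl opt; have ps_gt0 := star_product_gt0 lgk lgl.
have [Xc|notXc] := boolP (c \in X).
  have leH : #|H| <= stirling2 (n - t.+1) (l - t) + t.
    rewrite defH; apply: leq_trans (leq_card_Bfam l X M) _; rewrite cardX leq_add2r.
    exact: leq_card_Cfam_block cardX lt_tl Xc c_gt1.
  have leH72 : 72 * #|H| <= 38 * s.
    by have := double_star_size_shift lgl; have := t_le_star_size_t lgl; move: leH; clear; lia.
  exfalso; have := leq_mul leF leH72; move: ge_FH ps_gt0; clear -K_gt0.
  move: (l - t) K_gt0 p s #|F| #|H| => [//|K] _ x z f h; nia.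
have MXc : c \in M :\: X by rewrite inE notXc.
have leH : #|H| <= s + t.
  rewrite defH; apply: leq_trans (leq_card_Bfam l X M) _; rewrite cardX leq_add2r.
  exact: leq_card_Cfam cardX lt_tl.
have [lt_tk|le_kt] := ltnP t.+2 k; last first.
  have def_k : k = t.+2 by apply/eqP; rewrite eqn_leq le_kt (lg_index lgk).
  have p1 : p = 1 by rewrite -(star_size_pred lgk) def_k.
  by split=> //; apply: leq_trans (leq_mul leF leH) _; rewrite p1 muln1.
have le2F := leq_card_Afam_block lgk sXM cardX cardM MXc c_gt1 lt_tk; rewrite -defF in le2F.
exfalso; have := index_t_le_star_size_t lgl; move: ge_FH ps_gt0 leH le2F; clear -K_gt0.
move: (l - t) K_gt0 p s #|F| #|H| => [//|K] _ x z f h ge_fh xz_gt0 le_h le_f le_Kt.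
have {}le_f : 2 * f <= (2 * K + 1) * x by lia.
by have := leq_mul le_f le_h; have := leq_mul (leqnn x) le_Kt; lia.
Qed.

End OptimalSingletons.

Section Tie.
Variables (n t N l : nat) (F H : pfamily_of n).
Hypotheses (lgk : large_ground n t N t.+2) (lgl : large_ground n t N l).
Hypothesis opt : optimal_pair t t.+2 l F H.

Let le_tl : t.+2 <= l. Proof. exact: lg_index lgl. Qed.
Let lt_ln : l < n. Proof. exact: lg_ground lgl. Qed.

Lemma star_size_t_le_double : star_size n l t <= 2 * 2 ^ (n - l) * star_size n l t.+1.
Proof.
have := @stirling2SS_le (n - t.+1) (l - t.+1); rewrite /star_size.
have -> : (n - t.+1).+1 = n - t by lia.
have -> : (l - t.+1).+1 = l - t by lia.
have -> : n - t.+1 - (l - t.+1) = n - l by lia.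
by rewrite expnS; apply; lia.
Qed.

Lemma star_size_two_blocks : star_size n t.+2 t = (2 ^ (n - l) * 2 ^ (l - t.+1)).-1.
Proof.
rewrite /star_size -expnD; have -> : t.+2 - t = 2 by lia.
have -> : n - t = (n - t.+1).+1 by lia.
by rewrite stirling2_Sn2; congr (2 ^ _).-1; lia.
Qed.

(* The bound comes from the pair (D, C): the larger index takes the C side. *)
Lemma optimal_gt_tie : (l, t) <> (3, 1) ->
  (l - t) * (star_size n l t + t) < #|F| * #|H|.
Proof.
move=> neq_lt; have := optimal_ge_CD lgl lgk (optimal_pair_sym opt).
rewrite star_size_two_blocks mulnC [#|H| * _]mulnC.
have := t_le_star_size_t lgl; have := star_size_t_le_double.
have := star_size_gt0 lgl le_tl; have t_gt0 := lg_t_gt0 lgl.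
have a_gt1 : 1 < 2 ^ (n - l) by rewrite -{1}(expn1 2) leq_exp2l // subn_gt0.
have [j def_l] : exists j, l = j + t.+2 by exists (l - t.+2); rewrite subnK.
have [-> ->] : l - t.+1 = j.+1 /\ l - t = j.+2 by lia.
have [c_gt c_large] : j.+2 <= 2 ^ j.+1 /\ (0 < j -> 4 * j.+2 <= 3 * 2 ^ j.+1).
  split; first exact: ltn_expl.
  by elim: (j) => // -[|i] // IHi _; rewrite expnS; have := IHi isT; lia.
have {neq_lt} large : 0 < j \/ 1 < t.
  by case: (j) def_l neq_lt => [|i] ->; [case: (t) t_gt0 => [|[|m]] | ]; auto.
clear lgk lgl opt le_tl lt_ln def_l.
move: (2 ^ (n - l)) a_gt1 (2 ^ j.+1) c_gt c_large => a a_gt1 c c_gt c_large.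
move: (star_size n l t.+1) (star_size n l t) (#|F| * #|H|) => x z FH x_gt0 le_z le_tz ge_FH.
rewrite ltnNge; apply/negP=> le_FH.
have le_ac : (18 * t + 17) * (a * c).-1 <= 37 * (j.+2 * a).
  rewrite -(leq_pmul2r x_gt0); have := leq_mul (leqnn j.+2) le_z.
  by have := leq_mul (leqnn j.+2) le_tz; lia.
have ge_ac : 2 * j.+2 <= a * c := leq_mul a_gt1 c_gt.
case: large => [j_gt0|t_gt1].
  have ge_t : 35 <= 18 * t + 17 by lia.
  by have := leq_mul (leqnn a) (c_large j_gt0); have := leq_mul ge_t (leqnn (a * c).-1); lia.
have ge_t : 53 <= 18 * t + 17 by lia.
by have := leq_mul (leqnn a) c_gt; have := leq_mul ge_t (leqnn (a * c).-1); lia.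
Qed.

End Tie.

Lemma leq_sqr_pow_excess n t N k e :
  large_ground n t N k -> n <= t + (3 * e + 2) -> N ^ 2 <= 2 ^ e.
Proof.
move=> lg le_n; rewrite -(@leq_exp2r _ _ 3) // -!expnM [e * 3]mulnC.
rewrite -(leq_pmul2l (m := 4 ^ (t + 1))) ?expn_gt0 //.
apply: leq_trans (lg_pow lg) _; rewrite -[4]/(2 ^ 2) -expnM -expnD leq_exp2l //.
by lia.
Qed.

Section SingleMember.
Variables (n t N l : nat) (P : spart n) (H : pfamily_of n).
Implicit Types (G W : spart n) (c : block n).
Hypotheses (lgk : large_ground n t N t.+2) (lgl : large_ground n t N l).
Hypothesis opt : optimal_pair t t.+2 l [set P] H.

Local Notation s := (star_size n l t).

Let cp : cross_pair t t.+2 l [set P] H. Proof. exact: optimal_cross opt. Qed.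
Let partP : partition P setT.
Proof. by apply: (sub_Pi_partition (cross_subl cp)); rewrite inE. Qed.
Let cardP : #|P| = t.+2.
Proof. by apply: (sub_Pi_card (cross_subl cp)); rewrite inE. Qed.

Variable b : block n.
Hypotheses (Pb : b \in P) (max_b : forall c, c \in P -> #|c| <= #|b|).
Local Notation T := (P :\ b).

Let cardT : #|T| = t.+1. Proof. exact: cardsD1_succ. Qed.

Lemma cover_or_pair G : G \in H ->
  t <= #|T :&: G| \/ [/\ b \in G, #|T :\: G| = 2 & P :\: (T :\: G) \subset G].
Proof.
move=> GH; have [|lt_TG] := leqP t #|T :&: G|; [by left | right].
have le_t : t <= (b \in G) + #|T :&: G|.
  apply: leq_trans (leq_card_setU1I _ _ _); rewrite setD1K //.
  by apply: (crossP cp); rewrite ?inE.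
have Gb : b \in G.
  by move: le_t; case: (b \in G) => //; rewrite add0n leqNgt lt_TG.
split=> //.
  rewrite cardsD cardT; rewrite Gb in le_t; move: lt_TG le_t; move: #|T :&: G| => m.
  by clear; lia.
apply/subsetP=> B; rewrite !inE !negb_and !negbK => /andP[/or3P[//|/eqP->//|notPB]] PB.
by rewrite PB in notPB.
Qed.

(* The two blocks of [W] are not larger than [b], so the blocks of [P :\: W] cover at
   least about a third of the ground set. *)
Lemma through_pair_bound W : W \subset T -> #|W| = 2 ->
  N ^ 2 * #|through H (P :\: W)| <= s.
Proof.
move=> sWT cardW; have sWP : W \subset P by apply: subset_trans sWT (subD1set _ _).
have lt_tl : t.+2 <= l := lg_index lgl.
set Y := P :\: W; have sYP : Y \subset P by apply: subsetDl.
have cardY : #|Y| = t by rewrite cardsD (setIidPr sWP) cardP cardW -addn2 addnK.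
have partY := sub_partition_cover partP sYP.
have Yb : b \in Y by rewrite inE Pb andbT; apply/negP=> /(subsetP sWT); rewrite !inE eqxx.
have le_b := leq_card_cover_block partY Yb; rewrite cardY in le_b.
have b_gt0 : 0 < #|b| by rewrite card_gt0 (partition_neq0 partP Pb).
have partW := sub_partition_cover partP sWP.
have def_n : n = #|cover Y| + #|cover W|.
  rewrite (card_partition partY) (card_partition partW) addnC -[LHS](card_ord n) -cardsT.
  by rewrite (card_partition partP) (big_setID W) (setIidPr sWP).
have le_Wb : #|cover W| <= 2 * #|b|.
  rewrite (card_partition partW) -cardW -sum_nat_const; apply: leq_sum => c Wc.
  exact: max_b (subsetP sWP c Wc).
apply: leq_trans (leq_mul (leqnn _) (subset_leq_card (sub_through_Cfam _ (cross_subr cp)))) _.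
have le_tl : t <= l := ltnW (ltnW lt_tl).
rewrite card_Cfam ?cardY // {1}def_n addKn /star_size.
move: #|cover Y| #|cover W| #|b| def_n le_b b_gt0 le_Wb => u v m def_n le_b m_gt0 le_v.
have t_gt0 := lg_t_gt0 lgl; have l_gt1 : 1 < l - t by rewrite ltn_subRL addn1.
have le_N : N ^ 2 <= 2 ^ (u - t).
  by apply: (leq_sqr_pow_excess lgl); clear -def_n le_b m_gt0 le_v t_gt0; lia.
have -> : n - t = v + (u - t) by clear -def_n le_b m_gt0 t_gt0; lia.
by apply: leq_trans (leq_expn_stirling2 _ _ l_gt1); rewrite leq_mul2r le_N orbT.
Qed.

Lemma leq_card_H_of_large_block c : c \in T -> 1 < #|c| ->
  36 * #|H| <= (18 * t + 38) * s.
Proof.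
move=> Tc c_gt1; pose e := s %/ N ^ 2.
have le_H : #|H| <= #|Dfam n l t T| + 'C(t.+1, 2) * e.
  rewrite -(cardsID (Dfam n l t T) H) leq_add ?subset_leq_card ?subsetIr //.
  rewrite -cardT -cards_draws.
  apply: (leq_card_covered_mul (B := fun W => through H (P :\: W))) => [G /setDP[GH notDG]|W].
    have [tG|[_ cardTG sPG]] := cover_or_pair GH.
      by case/negP: notDG; apply/setIdP; rewrite (subsetP (cross_subr cp)).
    by exists (T :\: G); rewrite inE ?GH // subsetDl cardTG.
  rewrite inE => /andP[sWT /eqP cardW]; rewrite leq_divRL; last first.
    by rewrite expn_gt0 (leq_ltn_trans _ (lg_N_gt5 lgl)).
  by rewrite mulnC through_pair_bound.
have le_D := leq_card_Dfam_block lgl cardT Tc c_gt1.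
have le_e : 18 * ('C(t.+1, 2) * e) <= s.
  rewrite mulnA; apply: leq_trans (leq_mul (bin2_t_scale lgl) (leqnn e)) _.
  by rewrite mulnC leq_divM.
by move: le_H le_D le_e; clear; lia.
Qed.

Lemma largest_complement_singletons : singletons T.
Proof.
apply: contraT => notsT.
have T0 : set0 \notin T by rewrite inE (partition0 partP) andbF.
have [c Tc c_gt1] := not_singletons_block T0 notsT.
have := optimal_ge_CD lgk lgl opt; have := leq_card_H_of_large_block Tc c_gt1.
have := star_size_gt0 lgl (ltnW (lg_index lgl)); have := lg_t_gt0 lgl.
rewrite cards1 (star_size_pred lgk : star_size n t.+2 t.+1 = 1) !mul1n.
by move: s #|H|; clear; nia.
Qed.

(* If [b] is a block of [G], the other blocks of [G] partition the [t.+1] points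
   outside [b] into at least [t.+1] parts. *)
Lemma largest_complement_tcover : tcover t H T.
Proof.
have sT := largest_complement_singletons; have partT := singletons_partition sT.
apply/tcoverP=> G GH; have [//|[Gb _ _]] := cover_or_pair GH.
have partG := sub_Pi_partition (cross_subr cp) GH.
have coverE : cover (G :\ b) = cover T.
  rewrite !coverD1 ?(partition_trivIset partG) ?(partition_trivIset partP) //.
  by rewrite (cover_partition partG) (cover_partition partP).
have partGb := sub_partition_cover partG (subD1set G b).
have cardGb : #|G :\ b|.+1 = l.
  by rewrite -(sub_Pi_card (cross_subr cp) GH); apply: cardsD1_mem.
suff sTG : T \subset G by rewrite (setIidPl sTG) cardT.
apply/subsetP=> A TA; have [y defA] := singletonsP _ sT A TA.
have /bigcupP[B GbB By] : y \in cover (G :\ b).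
  by rewrite coverE; apply/bigcupP; exists A; rewrite // defA set11.
have := leq_card_cover_block partGb GbB.
rewrite coverE (card_cover_singletons sT) cardT => le_B.
have card_B : #|B| <= 1.
  move: #|B| le_B => m; have := lg_index lgl; rewrite -cardGb; move: #|_ :\ b| => r.
  by clear; lia.
have [_ GB] := setD1P GbB; suff -> : A = B by [].
by rewrite defA; apply/eqP; rewrite eqEcard sub1set By cards1.
Qed.

End SingleMember.

Lemma CD_form_of_single_member n t N l (P : spart n) (H : pfamily_of n) :
  large_ground n t N t.+2 -> large_ground n t N l ->
  optimal_pair t t.+2 l [set P] H -> CD_form t t.+2 l [set P] H.
Proof.
move=> lgk lgl opt; have sF := cross_subl (optimal_cross opt).
have cardP : #|P| = t.+2 by apply: (sub_Pi_card sF); rewrite inE.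
have /set0Pn[b0 Pb0] : P != set0 by rewrite -card_gt0 cardP.
case: (arg_maxnP (fun B : block n => #|B|) (Pb0 : mem P b0)) => b Pb max_b.
apply: (CD_form_of_cover lgk lgl opt (T := P :\ b)); first exact: cardsD1_succ.
  by move=> Q; rewrite inE => /eqP->; apply: subD1set.
exact: (largest_complement_tcover lgk lgl opt Pb max_b).
Qed.

(** * Relabelling the ground set *)

Section InjectiveEndo.
Variables (T : finType) (f : T -> T).
Hypothesis f_inj : injective f.
Implicit Types A B : {set T}.

Lemma imset_inj_eq A B : (forall x, (f x \in B) = (x \in A)) -> f @: A = B.
Proof.
move=> memB; apply/setP=> y; rewrite -(f_invF f_inj y) memB.
exact: mem_imset.
Qed.

Lemma imset_injC A : f @: (~: A) = ~: (f @: A).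
Proof. by apply: imset_inj_eq => x; rewrite !in_setC mem_imset. Qed.

Lemma imset_injD A B : f @: (A :\: B) = f @: A :\: f @: B.
Proof. by apply: imset_inj_eq => x; rewrite !in_setD !mem_imset. Qed.

Lemma imset_injT : f @: setT = setT.
Proof. by apply: imset_inj_eq => x; rewrite !inE. Qed.

Lemma imset_inj_subset A B : (f @: A \subset f @: B) = (A \subset B).
Proof. by rewrite -!setD_eq0 -imset_injD imset_eq0. Qed.

End InjectiveEndo.

Section Relabel.
Variables (n : nat) (s : {perm 'I_n}).
Implicit Types (P X M T : spart n) (B : block n).

Let s_inj : injective s := @perm_inj _ s.
Let imset_s_inj : injective (fun B : block n => s @: B) := imset_inj s_inj.

Lemma perm_part_inj : injective (@perm_part n s).
Proof. exact: imset_inj imset_s_inj. Qed.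

Lemma card_perm_part P : #|perm_part s P| = #|P|.
Proof. exact: card_imset imset_s_inj. Qed.

Lemma perm_part_Pi k P : (perm_part s P \in Pi n k) = (P \in Pi n k).
Proof. by rewrite !inE /is_kpart card_perm_part -{1}(imset_injT s_inj) imset_partition. Qed.

Lemma perm_part_subset X P : (perm_part s X \subset perm_part s P) = (X \subset P).
Proof. exact: imset_inj_subset. Qed.

Lemma perm_part_setI X P : perm_part s (X :&: P) = perm_part s X :&: perm_part s P.
Proof. by apply: imsetI => B C _ _; apply: imset_s_inj. Qed.

Lemma perm_part_setD X P : perm_part s (X :\: P) = perm_part s X :\: perm_part s P.
Proof. exact: imset_injD. Qed.

Lemma perm_part_eq0 P : (perm_part s P == set0) = (P == set0).
Proof. exact: imset_eq0. Qed.

Lemma perm_part_absorb M B :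
  perm_part s (absorb M B) = absorb (perm_part s M) (s @: B).
Proof.
rewrite [LHS]imsetU -[[set _ | _ in M :\ B]]/(perm_part s _) perm_part_setD.
rewrite /perm_part !imset_set1 imsetU (imset_injC s_inj).
by rewrite cover_imset imset_cover.
Qed.

Lemma perm_Cfam k T : perm_fam s (Cfam n k T) = Cfam n k (perm_part s T).
Proof.
apply: (imset_inj_eq perm_part_inj) => P; rewrite ![_ \in Cfam _ _ _]in_set.
by rewrite perm_part_Pi perm_part_subset.
Qed.

Lemma perm_Dfam l t T : perm_fam s (Dfam n l t T) = Dfam n l t (perm_part s T).
Proof.
apply: (imset_inj_eq perm_part_inj) => P; rewrite ![_ \in Dfam _ _ _ _]in_set.
by rewrite perm_part_Pi -perm_part_setI card_perm_part.
Qed.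

Lemma perm_Afam k X M : perm_fam s (Afam n k X M) = Afam n k (perm_part s X) (perm_part s M).
Proof.
apply: (imset_inj_eq perm_part_inj) => P; rewrite ![_ \in Afam _ _ _ _]in_set.
by rewrite perm_part_Pi perm_part_subset -perm_part_setD -perm_part_setI perm_part_eq0.
Qed.

Lemma perm_Bfam l X M : perm_fam s (Bfam n l X M) = Bfam n l (perm_part s X) (perm_part s M).
Proof.
rewrite /perm_fam [LHS]imsetU -[[set _ | _ in [set _ in _ | _]]]/(perm_fam s (Cfam n l X)).
rewrite perm_Cfam; congr (_ :|: _); rewrite -!imset_comp.
by apply: eq_imset => B; apply: perm_part_absorb.
Qed.

End Relabel.

Lemma exists_perm_nth n (e : seq 'I_n) : uniq e -> size e = n ->
  exists s : {perm 'I_n}, forall i x0, s i = nth x0 e i.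
Proof.
move=> uniq_e size_e; pose f (i : 'I_n) := nth i e i.
have fE (i : 'I_n) x0 : f i = nth x0 e i by apply: set_nth_default; rewrite size_e.
have f_inj : injective f.
  move=> i j; rewrite (fE j i) => /eqP; rewrite nth_uniq ?size_e // => /eqP.
  exact: val_inj.
by exists (perm f_inj) => i x0; rewrite permE.
Qed.

Lemma imset_perm_nth n (e : seq 'I_n) (s : {perm 'I_n}) m : size e = n ->
  (forall x, x \in e) -> (forall i x0, s i = nth x0 e i) ->
  s @: [set i : 'I_n | i < m] = [set x in take m e].
Proof.
move=> size_e mem_e sE; apply/setP=> x; rewrite inE in_take //.
have lt_x : index x e < n by move: (mem_e x); rewrite -index_mem size_e.
have s_index : s (Ordinal lt_x) = x by rewrite (sE _ x) nth_index.
by rewrite -{1}s_index mem_imset ?inE //; apply: perm_inj.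
Qed.

Lemma exists_perm_initial n (A M : {set 'I_n}) : A \subset M -> exists s : {perm 'I_n},
  s @: [set i : 'I_n | i < #|A|] = A /\ s @: [set i : 'I_n | i < #|M|] = M.
Proof.
move=> sAM; pose eM := enum A ++ enum (M :\: A); pose e := eM ++ enum (~: M).
have mem_eM x : (x \in eM) = (x \in M).
  by rewrite mem_cat !mem_enum inE; case: (boolP (x \in A)) => // /(subsetP sAM)->.
have mem_e x : x \in e by rewrite mem_cat mem_eM mem_enum inE orbN.
have uniq_eM : uniq eM.
  rewrite cat_uniq !enum_uniq andbT /=; apply/hasPn=> x.
  by rewrite !mem_enum inE => /andP[].
have uniq_e : uniq e.
  rewrite cat_uniq uniq_eM enum_uniq andbT /=; apply/hasPn=> x.
  by rewrite /= mem_eM mem_enum inE.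
have size_eM : size eM = #|M| by rewrite -(card_uniqP uniq_eM); apply: eq_card.
have size_e : size e = n.
  by rewrite -(card_uniqP uniq_e) -[RHS]card_ord; apply: eq_card => x; rewrite mem_e.
have takeM : take #|M| e = eM by rewrite -size_eM take_size_cat.
have takeA : take #|A| e = enum A by rewrite cardE /e /eM -catA take_size_cat.
have [s sE] := exists_perm_nth uniq_e size_e; exists s.
rewrite !(imset_perm_nth _ size_e mem_e sE) takeA takeM.
by split; apply/setP=> x; rewrite inE ?mem_enum.
Qed.

Lemma singletonsE (T : finType) (Y : {set {set T}}) :
  singletons Y -> Y = [set [set x] | x in cover Y].
Proof.
move/singletonsP=> sY; apply/setP=> B; apply/idP/imsetP=> [YB|[x /bigcupP[C YC Cx] ->]].
  by have [x defB] := sY B YB; exists x; rewrite // (subsetP (bigcup_sup B YB)) // defB set11.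
by have [y defC] := sY C YC; move: Cx; rewrite defC inE => /eqP->; rewrite -defC.
Qed.

Lemma perm_part_sing n m (s : {perm 'I_n}) (T : spart n) : singletons T ->
  s @: [set i : 'I_n | i < m] = cover T -> perm_part s (sing n m) = T.
Proof.
move=> sT coverT; rewrite [RHS]singletonsE // -coverT /perm_part /sing -!imset_comp.
by apply: eq_in_imset => i _; rewrite /= imset_set1.
Qed.

Lemma exists_relabel_sing n (X M : spart n) : X \subset M -> singletons M ->
  exists s : {perm 'I_n}, perm_part s (sing n #|X|) = X /\ perm_part s (sing n #|M|) = M.
Proof.
move=> sXM sM; have sX := singletonsS sXM sM.
have sub_cover : cover X \subset cover M.
  by apply/bigcupsP=> B XB; apply: bigcup_sup; apply: (subsetP sXM).
have [s [imX imM]] := exists_perm_initial sub_cover; exists s.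
by split; apply: perm_part_sing; rewrite -?card_cover_singletons.
Qed.

Section CommonBlocksCase.
Variables (n t N k l : nat) (F H : pfamily_of n).
Hypotheses (lgk : large_ground n t N k) (lgl : large_ground n t N l).
Hypothesis opt : optimal_pair t k l F H.

Lemma CD_or_AB_form (X : spart n) : #|X| = t -> tcover t F X ->
  CD_form t k l F H \/ AB_form t k l F H.
Proof.
move=> cardX covX; have [nondeg|] := boolP ((t.+3 <= k) || (1 < #|F|)).
  exact: (CD_or_AB_form_of_common_blocks lgk lgl opt cardX covX (orP nondeg)).
rewrite negb_or -!leqNgt => /andP[le_k le_F]; left.
have def_k : k = t.+2 by apply/eqP; rewrite eqn_leq le_k (lg_index lgk).
have /cards1P[P defF] : #|F| == 1.
  by rewrite eqn_leq le_F card_gt0; case: (optimal_neq0 lgk lgl opt).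
move: lgk opt; rewrite def_k defF => lgk2 opt2.
exact: CD_form_of_single_member lgk2 lgl opt2.
Qed.

Lemma iso_CD_or_AB (X : spart n) : (k, l) <> (3, 3) -> #|X| = t -> tcover t F X ->
  iso_pair F H (C2 n k t) (D2 n l t) \/ iso_pair F H (A3 n k l t) (B2 n l t).
Proof.
move=> neq_kl cardX /(CD_or_AB_form cardX)[[T [cardT defF defH]]|].
  have sT := optimal_CD_singletons lgk lgl opt cardT defF defH.
  have [s [_ permT]] := exists_relabel_sing (subxx T) sT; rewrite cardT in permT.
  by left; exists s; rewrite perm_Cfam perm_Dfam permT.
case=> Y [M [[sYM cardY cardM partM] [defF defH]]].
have [sM|[def_k le_FH]] :=
    optimal_AB_singletons_or_tie lgk lgl opt sYM cardY cardM partM defF defH.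
  have [s [permY permM]] := exists_relabel_sing sYM sM.
  rewrite cardY cardM in permY permM.
  by right; exists s; rewrite perm_Afam perm_Bfam permY permM.
move: lgk opt neq_kl; rewrite def_k => lgk2 opt2 neq_kl.
have := optimal_gt_tie lgk2 lgl opt2; rewrite ltnNge le_FH => tie.
by case: tie => // -[def_l def_t]; case: neq_kl; rewrite def_l def_t.
Qed.

End CommonBlocksCase.

Lemma iso_pair_sym n (F H F' H' : pfamily_of n) : iso_pair F H F' H' -> iso_pair H F H' F'.
Proof. by case=> s [isoF isoH]; exists s. Qed.

Lemma optimal_exists_common_blocks n t N k l (F H : pfamily_of n) :
  large_ground n t N k -> large_ground n t N l -> l <= k -> optimal_pair t k l F H ->
  (exists2 X : spart n, #|X| = t & tcover t F X) \/
  (exists2 X : spart n, #|X| = t & tcover t H X).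
Proof.
move=> lgk lgl le_lk opt; have [F_neq0 H_neq0] := optimal_neq0 lgk lgl opt.
have small_cover (G : pfamily_of n) : G != set0 ->
    ~~ [exists X : spart n, (#|X| == t) && tcover t G X] -> forall T, tcover t G T -> t < #|T|.
  move=> G_neq0 /existsPn noX T covT; rewrite ltn_neqAle (leq_card_tcover G_neq0 covT) andbT.
  by move: (noX T); rewrite covT andbT eq_sym.
have [/existsP[X /andP[/eqP cardX covX]]|noF] :=
  boolP [exists X : spart n, (#|X| == t) && tcover t F X]; first by left; exists X.
have [/existsP[X /andP[/eqP cardX covX]]|noH] :=
  boolP [exists X : spart n, (#|X| == t) && tcover t H X]; first by right; exists X.
have := balanced_bound lgk lgl (optimal_cross opt) F_neq0 H_neq0 le_lk
  (small_cover _ F_neq0 noF) (small_cover _ H_neq0 noH).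
by rewrite leqNgt (optimal_gt_balanced lgk lgl opt).
Qed.

Theorem theorem1p4 (n t k1 k2 : nat) (F1 F2 : pfamily_of n) :
  0 < t -> t + 2 <= k2 -> k2 <= k1 -> (k1, k2) <> (3, 3) ->
  Rle (Rmult (INR 2) (L k1 t)) (INR n) ->
  F1 \subset Pi n k1 -> F2 \subset Pi n k2 ->
  cross_tint t F1 F2 -> nontrivial t F1 F2 ->
  (forall G1 G2 : pfamily_of n, G1 \subset Pi n k1 -> G2 \subset Pi n k2 ->
     cross_tint t G1 G2 -> nontrivial t G1 G2 ->
     #|G1| * #|G2| <= #|F1| * #|F2|) ->
  iso_pair F1 F2 (A3 n k1 k2 t) (B2 n k2 t) \/
  iso_pair F1 F2 (B2 n k1 t) (A3 n k2 k1 t) \/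
  iso_pair F1 F2 (C2 n k1 t) (D2 n k2 t) \/
  iso_pair F1 F2 (D2 n k1 t) (C2 n k2 t).
Proof.
move=> t_gt0; rewrite addn2 => le_tk2 le_k21 neq33 threshold sF1 sF2 cross ntr max.
have lg1 : large_ground n t ((t + 1) * (k1 - t + 1)) k1.
  by apply: large_ground_of_threshold; rewrite // leqnn (leq_trans le_tk2).
have lg2 : large_ground n t ((t + 1) * (k1 - t + 1)) k2.
  by apply: large_ground_of_threshold; rewrite // le_tk2.
have opt : optimal_pair t k1 k2 F1 F2.
  by split=> // G1 G2 [sG1 sG2 crossG]; apply: max.
have [[X cardX covX]|[X cardX covX]] := optimal_exists_common_blocks lg1 lg2 le_k21 opt.
  by have [|] := iso_CD_or_AB lg1 lg2 opt neq33 cardX covX; auto.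
have neq33' : (k2, k1) <> (3, 3) by case=> def_k2 def_k1; apply: neq33; rewrite def_k1 def_k2.
by have [/iso_pair_sym|/iso_pair_sym] :=
  iso_CD_or_AB lg2 lg1 (optimal_pair_sym opt) neq33' cardX covX; auto.
Qed.
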